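(* Let $G$ be a graph of order $n$. Then $\lambda(G)=n-3$ if and only if $G$ is one of the following graphs: 1. two parallel paths with an additional $K_1$ component; 2. $P_4$ or $P_5$; 3. two parallel paths such that any standard drawing has one of the following forms: (a) $P_1=\{x\}$ and $P_k$ where $k\ge 3$, and (i) for some $u,v,w$ that form a subpath of $P_k$, $N(x)=\{u,w\}$ or $N(x)=\{u,v,w\}$, or (ii) for an end vertex $v$ of $P_k$ with neighbor $w$ on $P_k$, $N(x)=\{w\}$ or $N(x)=\{v,w\}$; (b) $P_2=uv$ and $P_k$ with $N(u)\cap V(P_k)=N(v)\cap V(P_k)$, and if $k=1$, then $ux,vx\in E(G)$ where $V(P_1)=\{x\}$; (c) $P_3=uvw$ and $P_k$ where $N(u)=N(w)=\{v\}$ or $N(u)=N(w)=\{v,x\}$ for some $x$ on $P_k$; (d) $P_k=v_1v_2\cdots v_k$ and $P_j=w_1w_2\cdots w_j$ where $k,j\ge 2$, and the set of edges between $P_k$ and $P_j$ is one of $\{v_{k-1}w_1,\,v_kw_2\}$, $\{v_{k-1}w_1,\,v_kw_2,\,v_{k-1}w_2\}$, or $\{v_{k-1}w_1,\,v_kw_2,\,v_kw_1\}$.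
   Context: Graphs are finite, simple (no loops or multiple edges), undirected; $n=|V(G)|$ is the order of $G$ (at least 1). $N(v)$ denotes the open neighborhood of $v$ in $G$. $P_m$ is the path on $m$ vertices and $K_1$ the one-vertex graph. Standard zero forcing: a subset $S\subseteq V(G)$ is colored blue and all other vertices white. Standard color change rule: if a blue vertex has exactly one white neighbor, then that white neighbor becomes blue. $S$ is a zero forcing set if repeated application of the rule eventually turns all vertices blue. The zero forcing span $\lambda(G)$ is the number of distinct cardinalities $k$ for which there exist $Z,F\subseteq V(G)$ with $|Z|=|F|=k$ such that $Z$ is a zero forcing set and $F$ is not a zero forcing set. $G$ is a graph of two parallel paths if $G$ itself is not a path, and $V(G)$ can be partitioned into subsets $V_1$ and $V_2$ such that the subgraphs induced by $V_1$ and $V_2$ are paths, and $G$ can be drawn in the plane so that the paths induced by $V_1$ and $V_2$ are parallel line segments, and edges between $V_1$ and $V_2$ can be drawn as straight line segments that do not cross. Such a drawing is a standard drawing. In item 3 the two listed paths are the two paths (induced by $V_1$ and $V_2$) of the standard drawing.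
   Formalization: In 3(c) a condition is added: if k=1, the single vertex of P_k is not isolated. This excludes only the disjoint union of P_3 and K_1, which fits 3(c) as written but has λ=2 while n-3=1. *)

(* Defs.v *)
From HB Require Import structures.
From mathcomp Require Import all_boot all_order all_algebra.
From mathcomp Require Import reals.

Set Implicit Arguments.
Unset Strict Implicit.
Unset Printing Implicit Defensive.
Import Order.TTheory GRing.Theory Num.Theory.
Local Open Scope ring_scope.

(* A finite simple graph is a symmetric irreflexive relation [e] on a finType
   of vertices. *)

Section ZeroForcing.
Variables (T : finType) (e : rel T).

Definition nbhd (v : T) : {set T} := [set w | e v w].

Definition color_change : rel {set T} := fun S S' =>
  [exists v in S, exists w, (nbhd v :\: S == [set w]) && (S' == w |: S)].

(* [connect] is the reflexive transitive closure. *)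
Definition zero_forcing (S : {set T}) : bool := connect color_change S [set: T].

Definition zf_span : nat :=
  #|[set k : 'I_#|T|.+1 |
      [exists Z : {set T}, exists F : {set T},
        [&& #|Z| == k, #|F| == k, zero_forcing Z & ~~ zero_forcing F]]]|.

End ZeroForcing.

Section Paths.
Variables (T : finType) (e : rel T).

(* The subgraph induced by [V] is a path, and [s] lists its vertices from one
   end to the other. *)
Definition path_listing (V : {set T}) (s : seq T) : Prop :=
  [/\ s != [::], uniq s, V = [set x in s] &
      {in s &, forall x y,
         e x y = (index y s == (index x s).+1) || (index x s == (index y s).+1)}].

Definition is_path_graph : Prop := exists s, path_listing [set: T] s.

End Paths.

Section Drawings.
Variables (R : realType) (T : finType) (e : rel T).

Definition open_segment (a b z : 'rV[R]_2) : Prop :=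
  exists2 t : R, 0 < t < 1 & z = (1 - t) *: a + t *: b.

(* The vertices of [s] are met in this order when one moves along the line
   through [a] in direction [d]. *)
Definition drawn_on_line (p : T -> 'rV[R]_2) (a d : 'rV[R]_2) (s : seq T) :
    Prop :=
  exists2 t : T -> R, {in s, forall x, p x = a + t x *: d} &
                      sorted <%R [seq t x | x <- s].

(* A one-vertex path is a degenerate segment, parallel to every direction.  The
   two carrying lines are distinct, so edges with a common end meet only there,
   and the condition of not crossing is that distinct edges between [V1] and
   [V2] have disjoint interiors. *)
Definition standard_drawing (p : T -> 'rV[R]_2) (V1 V2 : {set T}) : Prop :=
  [/\ V1 :|: V2 = [set: T],
      V1 :&: V2 = set0,
      exists s1 s2 a1 a2 d,
        [/\ path_listing e V1 s1 /\ drawn_on_line p a1 d s1,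
            path_listing e V2 s2 /\ drawn_on_line p a2 d s2,
            d != 0 &
            forall c : R, a2 - a1 != c *: d] &
      forall x y x' y', x \in V1 -> y \in V2 -> x' \in V1 -> y' \in V2 ->
        e x y -> e x' y' -> (x, y) != (x', y') ->
        forall z, ~ (open_segment (p x) (p y) z /\
                     open_segment (p x') (p y') z)].

Definition two_parallel_paths : Prop :=
  ~ is_path_graph e /\ exists p V1 V2, standard_drawing p V1 V2.

End Drawings.

Definition two_parallel_paths_plus_K1 (R : realType) (T : finType) (e : rel T) :
    Prop :=
  exists x : T, nbhd e x = set0 /\
    two_parallel_paths R
      (fun a b : {y : T | y != x} => e (val a) (val b)).

Section Forms.
Variables (T : finType) (e : rel T).
Local Notation N := (nbhd e).

(* In each form, [s], [s1], [s2] list a path in either of its two directions. *)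

Definition form_a (V1 V2 : {set T}) : Prop :=
  exists x s, [/\ V1 = [set x], path_listing e V2 s, (3 <= size s)%N &
    (exists u v w p q, s = p ++ [:: u; v; w] ++ q /\
       (N x = [set u; w] \/ N x = [set u; v; w]))
    \/ (exists v w q, s = [:: v, w & q] /\
          (N x = [set w] \/ N x = [set v; w]))].

Definition form_b (V1 V2 : {set T}) : Prop :=
  exists u v, [/\ path_listing e V1 [:: u; v],
    exists s, path_listing e V2 s,
    N u :&: V2 = N v :&: V2 &
    forall x, V2 = [set x] -> e u x /\ e v x].

(* The last clause excludes only the disjoint union of P_3 and K_1: it has
   order 4 and span 2, as both 2 and 3 are cardinalities of zero forcing sets
   and of sets that are not zero forcing. *)
Definition form_c (V1 V2 : {set T}) : Prop :=
  exists u v w, [/\ path_listing e V1 [:: u; v; w],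
    exists s, path_listing e V2 s,
    (N u = [set v] /\ N w = [set v])
      \/ (exists2 x, x \in V2 & N u = [set v; x] /\ N w = [set v; x]) &
    forall x, V2 = [set x] -> N x != set0].

(* [v'; v] are the last two vertices of the first path, [w; w'] the first two
   of the second. *)
Definition form_d (V1 V2 : {set T}) : Prop :=
  exists s1 s2 v' v w w',
    [/\ path_listing e V1 (s1 ++ [:: v'; v]),
        path_listing e V2 ([:: w; w'] ++ s2) &
        let E := [set xy in setX V1 V2 | e xy.1 xy.2] in
        [\/ E = [set (v', w); (v, w')],
            E = [set (v', w); (v, w'); (v', w')] |
            E = [set (v', w); (v, w'); (v, w)]]].

Definition listed_form (V1 V2 : {set T}) : Prop :=
  [\/ form_a V1 V2, form_b V1 V2, form_c V1 V2 | form_d V1 V2].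

End Forms.

(* Main.v *)
Require Import Defs.
From mathcomp Require Import all_boot all_order all_algebra.
From mathcomp Require Import reals.
From mathcomp Require Import zify ring lra.
Import Order.TTheory GRing.Theory Num.Theory.

(* Call W a fort if it is nonempty and no vertex outside W has exactly one
   neighbour in W.  A set is zero forcing iff it meets every fort, so with Z the
   zero forcing number and f the least size of a fort, the cardinalities
   counted by the span are those from Z to n - f, and the span is n - 3 iff
   Z + f = 4.
   - f = 1 iff there is an isolated vertex, and deleting it decreases Z by one.
   - Z = 1 iff G is a path, where f is about n / 2.
   - Z = 2 iff G is a graph of two parallel paths (Row): two forcing chains are
     parallel paths, and conversely the two first vertices of a drawing force.
   - f = 2 iff no vertex is isolated and two vertices a, b have the same
     neighbours outside {a, b}.  In a standard drawing such a, b lie on one path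
     (forms b, c) or on different ones (forms a, d); the condition of not
     crossing leaves only the listed possibilities. *)

Set Implicit Arguments.
Unset Strict Implicit.
Unset Printing Implicit Defensive.

(** * Forts and the zero forcing span *)

Section Forts.
Variables (T : finType) (e : rel T).

Definition fort (W : {set T}) : bool :=
  (W != set0) && [forall v, (v \notin W) ==> (#|nbhd e v :&: W| != 1)].

Lemma fort_other_nbr (W : {set T}) v w :
  fort W -> v \notin W -> w \in W -> e v w ->
  exists2 w', w' \in W & e v w' && (w' != w).
Proof.
case/andP=> _ /forallP/(_ v) /implyP fW vW wW evw.
have := fW vW; case: (set_0Vmem ((nbhd e v :&: W) :\ w)) => [E|[w' ]].
  by rewrite (cardsD1 w) E cards0 !inE evw wW.
by rewrite !inE => /and3P[nww' evw' w'W] _; exists w'; rewrite // evw'.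
Qed.

(** The first vertex of a fort to turn blue would be forced by a vertex outside the fort, whose
    other neighbour in the fort is still white. Conversely, the white vertices that remain when
    forcing stops form a fort. *)
Lemma zero_forcingP (S : {set T}) :
  reflect (forall W, fort W -> ~~ [disjoint W & S]) (zero_forcing e S).
Proof.
apply: (iffP idP) => [/connectP[p] | hitS].
  elim: p S => [|S' p IHp] S /=.
    move=> _ <- W /andP[W0 _]; apply: contraNN W0.
    by rewrite -setI_eq0 setIT.
  case/andP=> /exists_inP[v vS /existsP[w /andP[/eqP Nv /eqP ->]]].
  move=> /IHp{}IHp /IHp{}IHp W fW; apply: contra (IHp W fW) => dWS.
  rewrite -setI_eq0 setIUr setU_eq0 !setI_eq0 dWS andbT disjoint_sym disjoints1.
  apply/negP=> wW.
  have /setDP[] : w \in nbhd e v :\: S by rewrite Nv set11.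
  rewrite inE => evw _; have vW : v \notin W by rewrite (disjointFl dWS).
  have [w' w'W /andP[evw' /eqP[]]] := fort_other_nbr fW vW wW evw.
  by apply/set1P; rewrite -Nv !inE evw' (disjointFr dWS).
pose P S' := connect (color_change e) S S'.
(* A reachable set of maximal size allows no further force, so its complement is empty or a fort. *)
case: (@arg_maxnP _ S P (fun S' => #|S'|) (connect0 _ S)) => S' PS' maxS'.
have [|W0] := eqVneq (~: S') set0.
  move/(congr1 (@setC T)); rewrite setCK setC0 => E.
  by rewrite /zero_forcing -E.
have /hitS/negP[] : fort (~: S').
  rewrite /fort W0; apply/forallP=> v; apply/implyP; rewrite inE negbK => vS'.
  apply/cards1P=> -[w Nv]; have wS' : w \notin S'.
    by have := set11 w; rewrite -Nv !inE => /andP[].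
  have /maxS' : P (w |: S').
    apply: connect_trans PS' (connect1 _); apply/exists_inP; exists v => //.
    by apply/existsP; exists w; rewrite setDE Nv !eqxx.
  by rewrite cardsU1 wS' /= ltnn.
suff sSS' : S \subset S' by rewrite disjoint_sym disjoints_subset setCK.
case/connectP: PS' => p; elim: p (S) => [|S2 p IHp] S1 /=; first by move=> _ ->.
case/andP=> /exists_inP[v _ /existsP[w /andP[_ /eqP ES2]]] /IHp{}IHp /IHp.
by apply: subset_trans; rewrite ES2 subsetUr.
Qed.

Lemma zero_forcingS (S S' : {set T}) :
  S \subset S' -> zero_forcing e S -> zero_forcing e S'.
Proof.
move=> sSS' /zero_forcingP hitS; apply/zero_forcingP=> W /hitS.
by apply: contra; apply: disjointWr.
Qed.

(** * Extremal sizes and the span *)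

Definition zf_number : nat :=
  #|[arg min_(S < [set: T] | zero_forcing e S) #|S|]|.

Definition fort_number : nat := #|[arg min_(W < [set: T] | fort W) #|W|]|.

Lemma zf_numberP :
  (exists2 S, zero_forcing e S & #|S| = zf_number) /\
  (forall S, zero_forcing e S -> zf_number <= #|S|).
Proof.
rewrite /zf_number; case: arg_minnP => [|S zS minS]; first exact: connect0.
by split; first exists S.
Qed.

Lemma zf_number_leP k :
  reflect (exists2 S : {set T}, zero_forcing e S & #|S| <= k) (zf_number <= k).
Proof.
apply: (iffP idP) => [le_k | [S zS le_k]]; have [[S' zS' cS'] minS] := zf_numberP.
  by exists S'; rewrite // cS'.
exact: leq_trans (minS _ zS) le_k.
Qed.

Hypothesis T_gt0 : 0 < #|T|.

Lemma fort_setT : fort [set: T].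
Proof.
rewrite /fort -card_gt0 cardsT T_gt0.
by apply/forallP=> v; rewrite !inE.
Qed.

Lemma fort_numberP :
  (exists2 W, fort W & #|W| = fort_number) /\
  (forall W, fort W -> fort_number <= #|W|).
Proof.
rewrite /fort_number; case: arg_minnP => [|W fW minW]; first exact: fort_setT.
by split; first exists W.
Qed.

Lemma fort_number_leP k :
  reflect (exists2 W : {set T}, fort W & #|W| <= k) (fort_number <= k).
Proof.
apply: (iffP idP) => [le_k | [W fW le_k]]; have [[W' fW' cW'] minW] := fort_numberP.
  by exists W'; rewrite // cW'.
exact: leq_trans (minW _ fW) le_k.
Qed.

Lemma fort_number_gt0 : 0 < fort_number.
Proof. by have [[W /andP[W0 _] <-] _] := fort_numberP; rewrite card_gt0. Qed.

Lemma zf_number_gt0 : 0 < zf_number.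
Proof.
have [[S /zero_forcingP/(_ _ fort_setT) hitS <-] _] := zf_numberP.
by rewrite card_gt0; apply: contra hitS => /eqP->; rewrite -setI_eq0 setI0.
Qed.

Lemma subset_of_card (A : {set T}) k :
  k <= #|A| -> exists2 B : {set T}, B \subset A & #|B| = k.
Proof.
move=> kA; exists [set x in take k (enum A)].
  by apply/subsetP=> x; rewrite inE => /mem_take; rewrite mem_enum.
rewrite cardsE (card_uniqP _) ?take_uniq ?enum_uniq //.
by rewrite size_takel // -cardE.
Qed.

(** Supersets of a zero forcing set force, so a minimum one can be padded to any larger size. *)
Lemma forcing_cardP k : k <= #|T| ->
  [exists Z : {set T}, (#|Z| == k) && zero_forcing e Z] = (zf_number <= k).
Proof.
move=> kT; apply/existsP/zf_number_leP => [[Z /andP[/eqP<- zZ]]|[S zS Sk]].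
  by exists Z.
have [|B sB cB] := @subset_of_card (~: S) (k - #|S|).
  by have := cardsC S; lia.
exists (S :|: B); rewrite (zero_forcingS (subsetUl _ _) zS) andbT.
rewrite cardsU disjoint_setI0 ?cards0 ?subn0 ?cB ?subnKC //.
by rewrite disjoint_sym disjoints_subset.
Qed.

(** A set that fails lies in the complement of some fort, and every subset of the complement of a
    minimum fort fails. *)
Lemma failed_cardP k : k <= #|T| ->
  [exists F : {set T}, (#|F| == k) && ~~ zero_forcing e F]
    = (k + fort_number <= #|T|).
Proof.
move=> kT; apply/existsP/idP => [[F /andP[/eqP<- zF]]|le_k].
  have [[W fW dWF]|noW] : (exists2 W, fort W & [disjoint W & F]) \/
      forall W, fort W -> ~~ [disjoint W & F].
  - case: (pickP [pred W | fort W && [disjoint W & F]]) => [W /andP[]|E].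
      by left; exists W.
    by right=> W fW; have /= := E W; rewrite fW /= => ->.
  - have [_ /(_ _ fW) le_f] := fort_numberP.
    rewrite -(cardsC F) leq_add2l (leq_trans le_f) // subset_leq_card //.
    by rewrite -disjoints_subset.
  by case/negP: zF; apply/zero_forcingP.
have [[W fW cW] _] := fort_numberP.
have [|F sF cF] := @subset_of_card (~: W) k.
  by have := cardsC W; lia.
exists F; rewrite cF eqxx; apply/zero_forcingP=> /(_ W fW)/negP[].
by rewrite disjoint_sym disjoints_subset.
Qed.

(** A set of n - f + 1 vertices omits fewer than f vertices, hence contains no fort in its
    complement and forces. The bound keeps the natural subtractions in the count of the span from
    truncating. *)
Lemma zf_number_fort_number : zf_number + fort_number <= #|T|.+1.
Proof.
have [[W fW cW] _] := fort_numberP.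
have f_gt0 := fort_number_gt0; have le_f : fort_number <= #|T|.
  by rewrite -cW max_card.
have := failed_cardP (leq_subr fort_number.-1 #|T|).
have -> : (#|T| - fort_number.-1 + fort_number <= #|T|) = false by lia.
move/negbT; rewrite negb_exists => /forallP noF.
have [|S _ cS] := @subset_of_card [set: T] (#|T| - fort_number.-1).
  by rewrite cardsT leq_subr.
have := noF S; rewrite cS eqxx /= negbK.
case: zf_numberP => _ minS /minS; rewrite cS leq_subRL.
  by rewrite addnC -ltnS -addnS prednK.
exact: leq_trans (leq_pred _) le_f.
Qed.

(** The counted cardinalities fill the interval from Z to n - f, which has n - f - Z + 1
    elements. *)
Lemma zf_spanE : zf_span e + (zf_number + fort_number) = #|T|.+1.
Proof.
have le_zf := zf_number_fort_number; have f_gt0 := fort_number_gt0.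
rewrite /zf_span.
have -> : [set k : 'I_#|T|.+1 | [exists Z : {set T}, exists F : {set T},
    [&& #|Z| == k, #|F| == k, zero_forcing e Z & ~~ zero_forcing e F]]]
    = [set k : 'I_#|T|.+1 | (zf_number <= k) && (k < #|T|.+1 - fort_number)].
  apply/setP=> k; rewrite !inE.
  have le_k : k <= #|T| by rewrite -ltnS.
  have -> : (k < #|T|.+1 - fort_number) = (k + fort_number <= #|T|) by lia.
  rewrite -forcing_cardP // -failed_cardP //.
  apply/existsP/andP => [[Z /existsP[F /and4P[cZ cF zZ zF]]]|[]].
    by split; apply/existsP; [exists Z; rewrite cZ | exists F; rewrite cF].
  case/existsP=> Z /andP[cZ zZ] /existsP[F /andP[cF zF]]; exists Z.
  by apply/existsP; exists F; rewrite cZ cF zZ.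
(* The cardinality becomes a sum of ones over an interval of natural numbers. *)
rewrite -sum1dep_card -(big_mkord (fun k => (_ <= k) && (k < _)) (fun=> 1)).
rewrite -(big_nat_widen _ _ _ (fun k => zf_number <= k)) ?leq_subr //.
rewrite -(big_nat_widenl _ _ _ predT) // sum_nat_const_nat muln1.
lia.
Qed.

(** * Forts with at most two vertices *)

Hypotheses (e_sym : symmetric e) (e_irr : irreflexive e).

Lemma fort_number_le1P : reflect (exists x, nbhd e x = set0) (fort_number <= 1).
Proof.
apply: (iffP (fort_number_leP 1)) => [[W fW W1]|[x Nx]]; last first.
  exists [set x]; rewrite ?cards1 // /fort -card_gt0 cards1.
  apply/forallP=> v; apply/implyP=> _; rewrite (_ : _ :&: _ = set0) ?cards0 //.
  apply/setP=> y; rewrite !inE; apply/andP=> -[evy /eqP yx].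
  suff : v \in nbhd e x by rewrite Nx inE.
  by rewrite inE e_sym -yx.
have /cards1P[x Wx] : #|W| == 1.
  by rewrite eqn_leq W1 card_gt0; case/andP: fW.
exists x; apply/setP=> v; rewrite !inE; apply/negP=> exv.
have vW : v \notin W by rewrite Wx inE; apply: contraTneq exv => ->; rewrite e_irr.
have xW : x \in W by rewrite Wx set11.
rewrite e_sym in exv; have [w] := fort_other_nbr fW vW xW exv.
by rewrite Wx inE => /eqP->; rewrite eqxx andbF.
Qed.

(** The value of [e a b] is left free, so adjacent and nonadjacent twins are both covered. *)
Definition twins (a b : T) : Prop :=
  a != b /\ forall c, c != a -> c != b -> e a c = e b c.

(** A pair is a fort exactly when every outside vertex sees both of its members or neither. *)
Lemma fort_number_le2P :
  fort_number <= 2 <-> (exists x, nbhd e x = set0) \/ exists a b, twins a b.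
Proof.
split=> [|[/fort_number_le1P|[a [b [nab tw]]]]]; last 1 first.
- apply/fort_number_leP; exists [set a; b]; rewrite ?cards2 ?nab //.
  rewrite /fort -card_gt0 cards2 nab; apply/forallP=> v; apply/implyP.
  rewrite !inE negb_or => /andP[va vb]; have := tw v va vb.
  rewrite -[#|_|]/(#|nbhd e v :&: (a |: [set b])|) setIUr.
  rewrite [e a v]e_sym [e b v]e_sym => Ev.
  have N1 y : nbhd e v :&: [set y] = if e v y then [set y] else set0.
    apply/setP=> z; case: ifP => evy; rewrite !inE;
      by case: eqP => [->|]; rewrite ?evy ?andbF.
  by rewrite !N1 Ev; case: ifP; rewrite ?setU0 ?cards0 // cards2 nab.
- case/fort_number_leP=> W fW W2; case: (leqP #|W| 1) => W1.
    by left; apply/fort_number_le1P/fort_number_leP; exists W.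
  have /cards2P[a [b [nab W_ab]]] : #|W| == 2 by rewrite eqn_leq W2.
  right; exists a, b; split=> // c ca cb.
  have cW : c \notin W by rewrite W_ab !inE negb_or ca cb.
  have other x y : W = [set x; y] -> e c x -> e c y.
    move=> Wxy ecx; have xW : x \in W by rewrite Wxy !inE eqxx.
    have [w] := fort_other_nbr fW cW xW ecx.
    by rewrite Wxy !inE => /orP[]/eqP-> /andP[// _ /eqP].
  rewrite ![e _ c]e_sym; apply/idP/idP; apply: other => //.
  by rewrite W_ab setUC.
- by move/leq_trans; apply.
Qed.

End Forts.

(** * Zero forcing number at most two *)

Section Layouts.
Variables (T : finType) (e : rel T).
Hypotheses (e_sym : symmetric e) (e_irr : irreflexive e).
Implicit Types (s : seq T).

Definition induced_path s : Prop :=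
  {in s &, forall x y,
     e x y = (index y s == (index x s).+1) || (index x s == (index y s).+1)}.

(** Combinatorial substitute for a planar drawing. The second comparison is weak because two edges
    may share an end. *)
Definition noncrossing s1 s2 : Prop :=
  {in s1 &, forall x x', {in s2 &, forall y y', e x y -> e x' y' ->
     index x s1 < index x' s1 -> index y s2 <= index y' s2}}.

Definition layout s1 s2 : Prop :=
  [/\ uniq (s1 ++ s2), induced_path s1, induced_path s2 & noncrossing s1 s2].

Lemma noncrossingC s1 s2 : noncrossing s1 s2 -> noncrossing s2 s1.
Proof.
move=> nc y y' ys ys' x x' xs xs' eyx eyx' lt_y.
rewrite leqNgt; apply/negP=> /(nc _ _ xs' xs _ _ ys' ys).
by rewrite ![e _ y]e_sym ![e _ y']e_sym => /(_ eyx' eyx); rewrite leqNgt lt_y.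
Qed.

Lemma layoutC s1 s2 : layout s1 s2 -> layout s2 s1.
Proof. by case=> us i1 i2 /noncrossingC nc; split; rewrite // uniq_catC. Qed.

(* A forcing chain grows only at its last vertex, so a coloured vertex that
   still has a white neighbour ends one of the two chains. *)
Definition chains (S : {set T}) s1 s2 : Prop :=
  [/\ layout s1 s2, S =i s1 ++ s2 & forall v w, v \in S -> w \notin S -> e v w ->
      ((index v s1).+1 == size s1) || ((index v s2).+1 == size s2)].

Lemma chainsC S s1 s2 : chains S s1 s2 -> chains S s2 s1.
Proof.
case=> /layoutC ly ES last; split=> // [x|v w vS wS /last].
  by rewrite ES !mem_cat orbC.
by rewrite orbC => ->.
Qed.

(** By the last clause of [chains], the white vertex [w] is adjacent only to the last vertices of
    the two chains. Appending it after [v] therefore keeps the first chain an induced path, and its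
    edges to the other chain cross nothing. Afterwards [v] has no white neighbour left, so the
    clause survives. *)
Lemma chains_rcons S s1 s2 v w : chains S s1 s2 ->
  (index v s1).+1 == size s1 -> nbhd e v :\: S = [set w] ->
  chains (w |: S) (rcons s1 w) s2.
Proof.
case=> -[us i1 i2 nc] ES last_v /eqP iv Nv.
have vs1 : v \in s1 by rewrite -index_mem iv.
have [wS evw] : w \notin S /\ e v w.
  by have := set11 w; rewrite -Nv !inE => /andP.
have [ws1 ws2] : w \notin s1 /\ w \notin s2.
  by apply/norP; rewrite -mem_cat -ES.
have s12 x : x \in s1 -> x \notin s2.
  by move: us; rewrite cat_uniq => /and3P[_ /hasPn us _]; apply: contraL => /us.
have ixs x : x \in s1 -> index x (rcons s1 w) = index x s1.
  by move=> xs1; rewrite -cats1 index_cat xs1.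
have iws : index w (rcons s1 w) = size s1.
  by rewrite -cats1 index_cat (negPf ws1) /= eqxx addn0.
(* A vertex missing from a list has the size of the list as its index, so the test
   [(index x s).+1 == size s] also implies membership. *)
have last1 x : x \in s1 -> e x w = ((index x s1).+1 == size s1).
  move=> xs1; have xS : x \in S by rewrite ES mem_cat xs1.
  apply/idP/idP=> [/(last_v _ _ xS wS)|].
    case/orP=> // /eqP ix; have := s12 x xs1.
    by rewrite -index_mem ix leqnn.
  by rewrite -iv eqSS => /eqP/index_inj->.
have last2 x : x \in s2 -> e x w -> (index x s2).+1 == size s2.
  move=> xs2; have xS : x \in S by rewrite ES mem_cat xs2 orbT.
  case/(last_v _ _ xS wS)/orP=> // /eqP ix.
  have /s12/negP[//] : x \in s1 by rewrite -index_mem ix.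
split; first split=> //.
- rewrite cat_rcons -cat_rcons cat_uniq rcons_uniq ws1 /=.
  move: us; rewrite cat_uniq => /and3P[-> us ->]; rewrite andbT /=.
  apply/hasPn=> x xs2; rewrite mem_rcons inE negb_or.
  by rewrite (hasPn us) // andbT; apply: contraTneq xs2 => ->.
- move=> x y; rewrite !mem_rcons !inE.
  case/predU1P=> [->|xs1] /predU1P[->|ys1]; rewrite ?iws ?ixs //.
  + by rewrite e_irr; lia.
  + have ys := ys1; rewrite -index_mem in ys.
    by rewrite e_sym last1 // [_ == (size s1).+1]ltn_eqF ?leqW //= eq_sym.
  + have xs := xs1; rewrite -index_mem in xs.
    by rewrite last1 // [_ == (size s1).+1]ltn_eqF ?leqW // orbF eq_sym.
  + exact: i1.
- move=> x x' + + y y' ys2 ys2' exy exy'; rewrite !mem_rcons !inE.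
  case/predU1P=> [E|xs1] /predU1P[E'|xs1']; subst; rewrite ?iws ?ixs ?ltnn //.
  + by rewrite ltnNge index_size.
  + move=> _; rewrite e_sym in exy'.
    by rewrite -ltnS (eqP (last2 _ ys2' exy')) index_mem.
  + exact: nc.
- by move=> x; rewrite in_setU1 cat_rcons mem_cat inE ES mem_cat orbCA.
- move=> x y; rewrite in_setU1 !inE negb_or.
  case/predU1P=> [->|xS] /andP[yw yS] exy; first by rewrite iws size_rcons eqxx.
  case/orP: (last_v _ _ xS yS exy) => [|->]; last by rewrite orbT.
  rewrite -iv eqSS => /eqP E; have xs1 : x \in s1 by rewrite -index_mem E index_mem.
  have : y \in nbhd e v :\: S by rewrite !inE yS -(index_inj v xs1 vs1 E).
  by rewrite Nv inE (negPf yw).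
Qed.

(** Each force extends the chain that its forcing vertex ends. An empty chain has no last vertex and
    stays empty, which lets the same induction serve for one path and for two. *)
Lemma chains_setT S s1 s2 : zero_forcing e S -> chains S s1 s2 ->
  exists t1 t2, [/\ chains [set: T] t1 t2, nilp t1 = nilp s1 & nilp t2 = nilp s2].
Proof.
case/connectP=> p; elim: p S s1 s2 => [|S' p IHp] S s1 s2 /=.
  by move=> _ <- ch; exists s1, s2.
have nilp_last s (v : T) : (index v s).+1 == size s -> nilp s = false.
  by case: s.
have nilp_rcons s (v : T) : nilp (rcons s v) = false by case: s.
case/andP=> /exists_inP[v vS /existsP[w /andP[/eqP Nv /eqP ->]]] pth lst ch.
have [_ _ /(_ v w vS)] := ch; have := set11 w; rewrite -Nv !inE => /andP[wS evw].
case/(_ wS evw)/orP=> last_v.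
  have [t1 [t2 [cht n1 n2]]] := IHp _ _ _ pth lst (chains_rcons ch last_v Nv).
  by exists t1, t2; rewrite n1 n2 nilp_rcons (nilp_last _ _ last_v).
have [t1 [t2 [cht n1 n2]]] :=
  IHp _ _ _ pth lst (chainsC (chains_rcons (chainsC ch) last_v Nv)).
by exists t1, t2; rewrite n1 n2 nilp_rcons (nilp_last _ _ last_v).
Qed.

(** Either list may be empty, so a graph that is a path is treated as a layout with one empty
    list. *)
Definition full_layout s1 s2 : Prop := layout s1 s2 /\ forall x, x \in s1 ++ s2.

(* In a fort that misses both first vertices, the predecessors of the first
   vertices met on the two paths must have neighbours further along the opposite
   paths, and these edges cross. *)
Lemma full_layout_zf s1 s2 : full_layout s1 s2 ->
  zero_forcing e [set x in take 1 s1 ++ take 1 s2].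
Proof.
case=> ly cov; apply/zero_forcingP=> W fW; apply/negP=> dW.
(* Here [x] comes just before the first vertex of [W] on [t1]. Its second neighbour in [W] is
   neither that vertex nor an earlier one on [t1], so it lies on [t2]. *)
have noncover_hit t1 t2 : full_layout t1 t2 -> [disjoint W & take 1 t1] ->
    has (mem W) t1 -> exists x y,
    [/\ x \in t1, y \in t2, y \in W, e x y & (index x t1).+1 = find (mem W) t1].
  case=> -[us i1 i2 nc] cv dW1 hW.
  have x0 : T by case: (t1) hW.
  have nthW := nth_find x0 hW; move: hW; rewrite has_find => hW.
  case Ei: (find (mem W) t1) hW nthW => [|i] hi nthW.
    case: (t1) dW1 hi nthW => //= x t' + _ xW; rewrite take0 disjoint_sym.
    by rewrite (eq_disjoint1 (x := x)) ?xW // => z; rewrite !inE.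
  move: us; rewrite cat_uniq => /and3P[u1 _ _].
  have ix : index (nth x0 t1 i) t1 = i by rewrite index_uniq // ltnW.
  have ix' : index (nth x0 t1 i.+1) t1 = i.+1 by rewrite index_uniq.
  have xW : nth x0 t1 i \notin W.
    by have /= -> := before_find x0 (a := mem W) (s := t1) (i := i) _; rewrite ?Ei.
  have exx' : e (nth x0 t1 i) (nth x0 t1 i.+1).
    by rewrite i1 ?mem_nth ?ix ?ix' ?eqxx // ltnW.
  have [y yW /andP[exy yx']] := fort_other_nbr fW xW nthW exx'.
  exists (nth x0 t1 i), y; split; rewrite ?mem_nth ?ix // 1?ltnW //.
  have := cv y; rewrite mem_cat => /orP[yt1|//].
  move: exy; rewrite i1 ?mem_nth // 1?ltnW // ix => /orP[]/eqP iy.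
    by case/eqP: yx'; rewrite -iy nth_index.
  have : index y t1 < find (mem W) t1 by rewrite Ei iy; lia.
  by move/(before_find x0); rewrite nth_index //= yW.
have mono t1 t2 : [disjoint W & [set x in take 1 t1 ++ take 1 t2]] ->
    [disjoint W & take 1 t1].
  move=> dWt; apply: disjointWr dWt; apply/subsetP=> x xt.
  by rewrite inE mem_cat xt.
have dW1 := mono _ _ dW.
have dW2 : [disjoint W & take 1 s2].
  apply: (mono _ s1); apply: disjointWr dW; apply/subsetP=> x.
  by rewrite !inE !mem_cat orbC.
have lyC : full_layout s2 s1.
  by split; [apply: layoutC | move=> x; rewrite mem_cat orbC -mem_cat].
have [] : has (mem W) s1 /\ has (mem W) s2.
  have [w wW] : exists w, w \in W by apply/set0Pn; case/andP: fW.
  have := cov w; rewrite mem_cat => /orP[] ws.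
    have h : has (mem W) s1 by apply/hasP; exists w.
    have [x [y [_ ys yW _ _]]] := noncover_hit _ _ (conj ly cov) dW1 h.
    by split=> //; apply/hasP; exists y.
  have h : has (mem W) s2 by apply/hasP; exists w.
  have [x [y [_ ys yW _ _]]] := noncover_hit _ _ lyC dW2 h.
  by split=> //; apply/hasP; exists y.
move=> /(noncover_hit _ _ (conj ly cov) dW1)[x [y [xs ys yW exy ix]]].
move=> /(noncover_hit _ _ lyC dW2)[y' [x' [ys' xs' xW' exy' iy]]].
(* Since [x] precedes all of [W] on [s1], it precedes [x']. Not crossing puts [y] no later than
   [y'], whereas [y'] precedes all of [W] on [s2]. *)
case: ly => _ _ _ /(_ x x' xs xs' y y' ys ys' exy); rewrite e_sym => /(_ exy').
have findW s z : z \in s -> z \in W -> find (mem W) s <= index z s.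
  move=> zs zW; rewrite leqNgt; apply/negP=> /(before_find z).
  by rewrite nth_index //= zW.
have := findW _ _ xs' xW'; have := findW _ _ ys yW; lia.
Qed.

(** With at most one vertex in each list, every coloured vertex ends its list, so the lists are
    valid initial chains. *)
Lemma zf_chains s1 s2 : uniq (s1 ++ s2) -> size s1 <= 1 -> size s2 <= 1 ->
  zero_forcing e [set x in s1 ++ s2] ->
  exists t1 t2, [/\ full_layout t1 t2, nilp t1 = nilp s1 & nilp t2 = nilp s2].
Proof.
move=> us sz1 sz2 /chains_setT zf.
have small s : size s <= 1 -> (forall x y, x \in s -> y \in s -> x = y) /\
    (forall x, x \in s -> (index x s).+1 == size s).
  case: s => [|x [|//]] //= _; split=> [y z|y]; rewrite !inE.
    by move=> /eqP-> /eqP->.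
  by move/eqP->; rewrite eqxx.
have [eq1 last1] := small _ sz1; have [eq2 last2] := small _ sz2.
have ind s : (forall x y, x \in s -> y \in s -> x = y) -> induced_path s.
  by move=> eqs x y xs ys; rewrite (eqs y x) // e_irr; lia.
have [] := zf s1 s2.
  split=> [|x|v w]; last by rewrite inE mem_cat => /orP[/last1|/last2] ->; rewrite ?orbT.
  - split; [by [] | exact: ind | exact: ind |].
    by move=> x x' xs xs' y y' ys ys' _ _; rewrite (eq1 x x') // ltnn.
  - by rewrite inE.
move=> t1 [t2 [[ly cov _] n1 n2]]; exists t1, t2; split=> //; split=> // x.
by rewrite -cov inE.
Qed.

Lemma path_listing_full s : path_listing e [set: T] s <-> full_layout s [::] /\ ~~ nilp s.
Proof.
rewrite /full_layout /layout /path_listing cats0; split.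
  case=> s0 us Es i1; split; last by case: (s) s0.
  by split; [split | move=> x; have := in_setT x; rewrite Es inE].
case=> -[[us i1 _ _] cov] s0; split=> //; first by case: (s) s0.
by apply/setP=> x; rewrite !inE cov.
Qed.

(** A single forcing vertex starts one chain that covers the graph; conversely the first vertex of a
    path forces. *)
Lemma zf_number_le1P : 0 < #|T| -> reflect (is_path_graph e) (zf_number e <= 1).
Proof.
move=> T0; apply: (iffP (zf_number_leP e 1)) => [[S zS S1]|[s]].
  have /cards1P[x Ex] : #|S| == 1.
    rewrite eqn_leq S1; have := zf_number_gt0 e T0.
    by case: (zf_numberP e) => _ /(_ _ zS); lia.
  have [//|//|//||t1 [t2 [ly n1 n2]]] := @zf_chains [:: x] [::].
    by rewrite (_ : [set _ in _] = S) // Ex; apply/setP=> y; rewrite !inE.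
  case: t2 n2 ly => // _ ly; exists t1; apply/path_listing_full.
  by rewrite n1.
case/path_listing_full=> /full_layout_zf zf _; exists [set x in take 1 s ++ take 1 [::]] => //.
by rewrite cats0 cardsE; apply: leq_trans (card_size _) _; rewrite size_take_min geq_minl.
Qed.

Lemma zf_number_le2P : ~ is_path_graph e -> zf_number e <= 2 ->
  0 < #|T| -> exists s1 s2, [/\ full_layout s1 s2, s1 != [::] & s2 != [::]].
Proof.
move=> npath + T0; case/zf_number_leP=> S zS S2.
have /cards2P[a [b [nab Eab]]] : #|S| == 2.
  rewrite eqn_leq S2 ltnNge; apply/negP=> S1; apply: npath; apply/zf_number_le1P=> //.
  by apply/zf_number_leP; exists S.
have [|//|//||t1 [t2 [ly n1 n2]]] := @zf_chains [:: a] [:: b].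
- by rewrite /= inE nab.
- by rewrite (_ : [set _ in _] = S) // Eab; apply/setP=> y; rewrite !inE.
by exists t1, t2; split=> //; [case: (t1) n1 | case: (t2) n2].
Qed.

Lemma full_layout_zf_number s1 s2 : full_layout s1 s2 -> zf_number e <= 2.
Proof.
move/full_layout_zf=> zf; apply/zf_number_leP.
exists [set x in take 1 s1 ++ take 1 s2] => //; rewrite cardsE.
apply: leq_trans (card_size _) _; rewrite size_cat !size_take_min.
by apply: (@leq_add _ _ 1 1); apply: geq_minl.
Qed.

End Layouts.

(** * Drawings *)

Section DrawingLayout.
Variables (R : realType) (T : finType) (e : rel T).
Hypotheses (e_sym : symmetric e) (e_irr : irreflexive e).
Implicit Types (s : seq T) (V : {set T}).
Local Open Scope ring_scope.

(** Two edges whose ends occur in opposite orders on the two parallel lines have a common interior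
    point. *)
Lemma standard_drawing_layout (p : T -> 'rV[R]_2) V1 V2 :
  standard_drawing e p V1 V2 ->
  exists s1 s2, [/\ path_listing e V1 s1, path_listing e V2 s2 & full_layout e s1 s2].
Proof.
case=> cov dis [s1 [s2 [a1 [a2 [d [[pl1 [t1 pt1 st1]] [pl2 [t2 pt2 st2]] _ _]]]]]] nocross.
exists s1, s2; split=> //.
have [_ u1 V1s i1] := pl1; have [_ u2 V2s i2] := pl2.
split; last by move=> x; have := in_setT x; rewrite -cov V1s V2s !inE mem_cat.
split=> //.
  rewrite cat_uniq u1 u2 andbT; apply/hasPn=> x xs2; apply/negP=> xs1.
  by have := in_set0 x; rewrite -dis V1s V2s !inE xs1 xs2.
move=> x x' xs1 xs1' y y' ys2 ys2' exy exy' lt_x; rewrite leqNgt; apply/negP=> lt_y.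
have mono (t : T -> R) s : sorted <%R [seq t z | z <- s] ->
    {in s &, forall z z', (index z s < index z' s)%N -> t z < t z'}.
  rewrite sorted_map => st z z' zs zs'; apply: (sorted_ltn_index _ st) => //.
  by move=> ? ? ?; apply: lt_trans.
have lt1 := mono _ _ st1 _ _ xs1 xs1' lt_x.
have lt2 := mono _ _ st2 _ _ ys2' ys2 lt_y.
(* Both edges are at the same point at parameter [r], the solution of [(1 - r) * (t1 x' - t1 x) = r
   * (t2 y - t2 y')]. *)
pose r := (t1 x' - t1 x) / ((t1 x' - t1 x) + (t2 y - t2 y')).
have den0 : 0 < (t1 x' - t1 x) + (t2 y - t2 y') by lra.
have r01 : 0 < r < 1.
  by rewrite divr_gt0 ?subr_gt0 //= ltr_pdivrMr // mul1r; lra.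
have Er : r * ((t1 x' - t1 x) + (t2 y - t2 y')) - (t1 x' - t1 x) = 0.
  by rewrite divfK ?subrr // gt_eqF.
have ne : (x, y) != (x', y') by apply: contraTneq lt_x => -[-> _]; rewrite ltnn.
have inV1 z : z \in s1 -> z \in V1 by rewrite V1s inE.
have inV2 z : z \in s2 -> z \in V2 by rewrite V2s inE.
apply: (nocross x y x' y' (inV1 _ xs1) (inV2 _ ys2) (inV1 _ xs1') (inV2 _ ys2')
  exy exy' ne ((1 - r) *: p x + r *: p y)).
split; exists r => //; rewrite (pt1 x) // (pt1 x') // (pt2 y) // (pt2 y') //; apply/rowP=> i; rewrite !mxE.
apply/eqP; rewrite -subr_eq0 -(mulr0 (d 0 i)) -[X in d 0 i * X]Er.
by apply/eqP; ring.
Qed.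

Lemma layout_standard_drawing s1 s2 : full_layout e s1 s2 ->
  s1 != [::] -> s2 != [::] ->
  exists p : T -> 'rV[R]_2, standard_drawing e p [set x in s1] [set x in s2].
Proof.
case=> -[us i1 i2 nc] cov s10 s20.
(* The vertices of [s1] go to the points (i, 0) and those of [s2] to the points (j, 1), where i and
   j are their indices. *)
pose d : 'rV[R]_2 := delta_mx 0 0; pose a : 'rV[R]_2 := delta_mx 0 1.
pose p x := if x \in s1 then (index x s1)%:R *: d else a + (index x s2)%:R *: d.
have := us; rewrite cat_uniq => /and3P[u1 /hasPn s21 u2].
have p1 x : x \in s1 -> p x = (index x s1)%:R *: d by rewrite /p => ->.
have p2 x : x \in s2 -> p x = a + (index x s2)%:R *: d.
  by rewrite /p => /s21/negPf/= ->.
have incr s : uniq s -> sorted <%R [seq (index x s)%:R : R | x <- s].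
  move=> u; rewrite (_ : map _ _ = [seq i%:R | i <- iota 0 (size s)]).
    rewrite sorted_map; apply: sub_sorted (iota_ltn_sorted 0 (size s)).
    by move=> i j; rewrite /= ltr_nat.
  rewrite map_comp; congr map; case: s u => // x s u.
  apply: (@eq_from_nth _ 0%N) => [|i]; rewrite ?size_map ?size_iota // => lt_i.
  by rewrite (nth_map x) // nth_iota // index_uniq.
exists p; split.
- by apply/setP=> x; rewrite !inE -mem_cat cov.
- by apply/setP=> x; rewrite !inE; apply/andP=> -[x1 /s21/negP].
- exists s1, s2, 0, a, d; split.
  + split; first by split.
    exists (fun x => (index x s1)%:R); last exact: incr.
    by move=> x /p1 ->; rewrite add0r.
  + split; first by split.
    by exists (fun x => (index x s2)%:R); [move=> x /p2 -> | exact: incr].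
  + apply/eqP=> /rowP/(_ 0); rewrite !mxE !eqxx /=; apply/eqP; exact: oner_neq0.
  + move=> c; apply/eqP=> /rowP/(_ 1); rewrite !mxE /= mulr0 subr0.
    by apply/eqP; exact: oner_neq0.
move=> x y x' y'; rewrite !inE => xs ys xs' ys' exy exy' ne z [].
case=> r r01 ->; case=> r' r01'; rewrite (p1 x) // (p1 x') // (p2 y) // (p2 y') // => E.
(* The second coordinate makes the two parameters equal. In the first coordinate, [noncrossing]
   makes one side strictly smaller unless [x = x'], and then [y = y'] as well. *)
have Er : r = r' by have /rowP/(_ 1) := E; rewrite !mxE /=; lra.
have Ei : (1 - r) * (index x s1)%:R + r * (index y s2)%:R
    = (1 - r) * (index x' s1)%:R + r * (index y' s2)%:R.
  by have /rowP/(_ 0) := E; rewrite !mxE /= -Er; lra.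
have absurd i j i' j' : (i < i')%N -> (j <= j')%N ->
    (1 - r) * i%:R + r * j%:R = (1 - r) * i'%:R + r * j'%:R -> False.
  rewrite -(ltr_nat R) -(ler_nat R) => lti lej.
  have : 0 < (1 - r) * (i'%:R - i%:R) by apply: mulr_gt0; lra.
  have : 0 <= r * (j'%:R - j%:R) by apply: mulr_ge0; lra.
  lra.
case: (ltngtP (index x s1) (index x' s1)) => ix.
- exact: absurd ix (nc _ _ xs xs' _ _ ys ys' exy exy' ix) Ei.
- by apply: absurd ix (nc _ _ xs' xs _ _ ys' ys exy' exy ix) _.
have Ex : x = x' by apply: (index_inj x xs xs').
move: Ei; rewrite ix => /addrI/mulfI => /(_ (lt0r_neq0 (andP r01).1))/eqP.
rewrite eqr_nat => /eqP/(index_inj x ys ys') Ey.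
by case/eqP: ne; rewrite Ex Ey.
Qed.

(** A layout bounds Z by 2, and the exclusion of paths removes exactly the case where Z is at most
    1. *)
Lemma two_parallel_pathsP : two_parallel_paths R e <-> zf_number e = 2%N.
Proof.
split=> [[npath [p [V1 [V2 /standard_drawing_layout]]]]|zf2].
  case=> [s1 [s2 [[s10 _ _ _] _ ly]]].
  have T0 : (0 < #|T|)%N by apply/card_gt0P; case: (s1) s10 => // x; exists x.
  apply/eqP; rewrite eqn_leq (full_layout_zf_number e_sym ly) ltnNge.
  by apply/negP=> /(zf_number_le1P e_sym e_irr T0).
have T0 : (0 < #|T|)%N.
  have [_ /(_ [set: T] (connect0 _ _))] := zf_numberP e.
  by rewrite zf2 cardsT; apply: leq_trans.
have npath : ~ is_path_graph e.
  by move/(zf_number_le1P e_sym e_irr T0); rewrite zf2.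
split=> //.
have [|s1 [s2 [ly s10 s20]]] := zf_number_le2P e_sym e_irr npath _ T0.
  by rewrite zf2.
have [p] := layout_standard_drawing ly s10 s20.
by exists p, [set x in s1], [set x in s2].
Qed.
End DrawingLayout.

(** * Deleting an isolated vertex *)

Section Isolated.
Variables (T : finType) (e : rel T) (x : T).
Hypotheses (e_sym : symmetric e) (x_isolated : nbhd e x = set0).
Let e' := fun a b : {y : T | y != x} => e (val a) (val b).

Let xv v : e v x = false.
Proof. by have := in_set0 v; rewrite -x_isolated inE e_sym. Qed.

Let nbhd'E v (W : {set {y : T | y != x}}) : nbhd e (val v) :&: (val @: W) = val @: (nbhd e' v :&: W).
Proof.
apply/setP=> y; rewrite !inE; apply/andP/imsetP=> [[evy /imsetP[w wW Ey]]|[w]].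
  by exists w; rewrite // !inE wW /e' -Ey evy.
by rewrite !inE => /andP[evw wW] ->; split=> //; apply/imsetP; exists w.
Qed.

Lemma fort_isolated1 : fort e [set x].
Proof.
rewrite /fort -card_gt0 cards1; apply/forallP=> v; apply/implyP=> _.
rewrite (_ : _ :&: _ = set0) ?cards0 //; apply/setP=> y; rewrite !inE.
by case: eqP => [->|]; rewrite ?xv ?andbF.
Qed.

Lemma fort_imset_val (W : {set {y : T | y != x}}) : fort e' W -> fort e (val @: W).
Proof.
case/andP=> W0 /forallP fW; rewrite /fort -card_gt0 card_imset ?card_gt0 ?W0 //=; last exact: val_inj.
apply/forallP=> v; apply/implyP; case: (eqVneq v x) => [->|vx].
  by rewrite x_isolated set0I cards0.
have -> : v = val (Sub v vx : {y : T | y != x}) by [].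
rewrite mem_imset; last exact: val_inj.
rewrite nbhd'E card_imset; last exact: val_inj.
by move/implyP: (fW (Sub v vx)).
Qed.

Lemma fort_preimset_val (W : {set T}) :
  fort e W -> x \notin W -> fort e' (val @^-1: W).
Proof.
case/andP=> W0 /forallP fW xW.
have EW : W = val @: (val @^-1: W : {set {y : T | y != x}}).
  apply/setP=> y; apply/idP/imsetP=> [yW|[w + ->]]; last by rewrite inE.
  have yx : y != x by apply: contraNneq xW => <-.
  by exists (Sub y yx); rewrite // inE.
rewrite /fort; apply/andP; split.
  by apply: contraNneq W0 => E0; rewrite EW E0 imset0.
apply/forallP=> v; apply/implyP; rewrite inE => vW.
by have /implyP/(_ vW) := fW (val v); rewrite {1}EW nbhd'E card_imset //; exact: val_inj.
Qed.

(** The set {x} is itself a fort, so every zero forcing set contains [x]. The forts avoiding [x] are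
    the images of the forts of the graph without [x], so adding or removing [x] translates zero
    forcing sets between the two graphs. *)
Lemma zf_number_isolated : zf_number e = (zf_number e').+1.
Proof.
have [[S zS cS] minS] := zf_numberP e; have [[S' zS' cS'] minS'] := zf_numberP e'.
have hit' := zero_forcingP _ _ zS'; have hit := zero_forcingP _ _ zS.
apply/eqP; rewrite eqn_leq; apply/andP; split.
  have -> : (zf_number e').+1 = #|x |: val @: S'|.
    rewrite cardsU1 card_imset ?cS'; last exact: val_inj.
    case: imsetP => // -[y _ Ey]; by have := valP y; rewrite -Ey eqxx.
  apply: minS; apply/zero_forcingP=> W fW; case: (boolP (x \in W)) => xW.
    by apply/negP=> dW; have := disjointFr dW xW; rewrite setU11.
  have := hit' _ (fort_preimset_val fW xW); apply: contra => dW.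
  rewrite -setI_eq0; apply/eqP/setP=> y; rewrite !inE; apply/andP=> -[yW yS'].
  by have := disjointFr dW yW; rewrite inE imset_f ?orbT.
have xS : x \in S by have := hit _ fort_isolated1; rewrite disjoints1 negbK.
rewrite -cS (cardsD1 x) xS ltnS.
have -> : #|S :\ x| = #|val @^-1: S : {set {y : T | y != x}}|.
  rewrite -(card_imset _ val_inj); apply: eq_card => y; rewrite !inE.
  apply/andP/imsetP=> [[yx yS]|[w + ->]]; first by exists (Sub y yx); rewrite ?inE.
  by rewrite inE => ->; rewrite (valP w).
apply: minS'; apply/zero_forcingP=> W /fort_imset_val/hit; apply: contra => dW.
rewrite -setI_eq0; apply/eqP/setP=> y; rewrite !inE; apply/andP=> -[/imsetP[w wW ->] wS].
by have := disjointFr dW wW; rewrite inE wS.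
Qed.

End Isolated.

(** * From the listed forms to twins *)

Section Listings.
Variables (T : finType) (e : rel T).
Hypotheses (e_sym : symmetric e).
Implicit Types (s : seq T) (V : {set T}).

(** Lets statements about the first vertices of a listing be applied to its last ones. Reversal
    replaces an index i by n - 1 - i, which preserves adjacency. *)
Lemma path_listing_rev V s : path_listing e V s -> path_listing e V (rev s).
Proof.
case=> s0 us Vs is_; split; rewrite ?rev_uniq //.
- by rewrite -nilpE /nilp size_rev -/(nilp s) nilpE.
- by rewrite Vs; apply/setP=> x; rewrite !inE mem_rev.
move=> x y; rewrite !mem_rev => xs ys; rewrite is_ // orbC.
have idx z : z \in s -> index z (rev s) + index z s = (size s).-1.
  move=> zs; have lt : index z (rev s) < size s.
    by rewrite -(size_rev s) index_mem mem_rev.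
  have E : z = nth z s (size s - (index z (rev s)).+1).
    by rewrite -nth_rev ?nth_index ?mem_rev.
  have -> : index z s = size s - (index z (rev s)).+1.
    by rewrite {1}E index_uniq // ltn_subrL (leq_ltn_trans _ lt).
  by rewrite -[size s in RHS](subnKC lt).
have arith a a' b b' n : a' + a = n.-1 -> b' + b = n.-1 -> a < n -> b < n ->
    (a == b.+1) || (b == a.+1) = (b' == a'.+1) || (a' == b'.+1) by lia.
by apply: arith (idx x xs) (idx y ys) _ _; rewrite index_mem.
Qed.

Lemma path_listing_adj V s x0 i c : path_listing e V s -> i < size s -> c \in V ->
  e (nth x0 s i) c = (index c s == i.+1) || (i == (index c s).+1).
Proof.
case=> _ us Vs is_ lt_i; rewrite Vs inE => cs.
by rewrite is_ ?mem_nth // index_uniq.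
Qed.

Lemma path_listing_index V s x0 i c : path_listing e V s -> i < size s -> c \in V ->
  (index c s == i) = (c == nth x0 s i).
Proof.
case=> _ us Vs is_ lt_i; rewrite Vs inE => cs.
by apply/eqP/eqP=> [<-|->]; rewrite ?nth_index ?index_uniq.
Qed.

Lemma path_listing_middle V s p q u v w c : path_listing e V s ->
  s = p ++ [:: u; v; w] ++ q -> c \in V -> e v c = (c == u) || (c == w).
Proof.
move=> pl Es cV.
have nth_p i : nth v s (size p + i) = nth v [:: u, v, w & q] i.
  by rewrite Es nth_cat -{2}[size p]addn0 ltn_add2l ltn0 addKn.
have sz : size p + 2 < size s by rewrite Es size_cat /= ltn_add2l.
have := nth_p 0; have := nth_p 1; have := nth_p 2 => /= Ew Ev Eu.
rewrite -{1}Ev (path_listing_adj _ pl) //; last by lia.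
rewrite -Ew -Eu -!(path_listing_index _ pl) //; lia.
Qed.

Lemma path_listing_end V q v w c : path_listing e V [:: v, w & q] ->
  c \in V -> e v c = (c == w).
Proof.
move=> pl cV.
by rewrite (path_listing_adj (i := 0) v pl) // orbF (path_listing_index v pl).
Qed.

Lemma not_isolated x y : e x y -> nbhd e x != set0.
Proof. by move=> exy; apply/set0Pn; exists y; rewrite inE. Qed.

Lemma path_listing_not_isolated V s x : path_listing e V s -> 2 <= size s -> x \in V ->
  nbhd e x != set0.
Proof.
case: s => [|v [|w q]] // pl _ xV; have [_ us Vs is_] := pl.
have [->|xv] := eqVneq x v.
  by apply: (@not_isolated _ w); rewrite (path_listing_end pl) // Vs !inE eqxx orbT.
move: xV; rewrite Vs inE => xs; pose i := index x [:: v, w & q].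
have i0 : 0 < i by rewrite /i /= [v == x]eq_sym (negPf xv).
have lt_i : i.-1 < size [:: v, w & q].
  by apply: leq_ltn_trans (leq_pred _) _; rewrite index_mem.
apply: (@not_isolated _ (nth x [:: v, w & q] i.-1)).
by rewrite is_ ?mem_nth // index_uniq // -/i prednK // eqxx orbT.
Qed.

(** The twins are [x] and [v] in form (a), the two vertices of P_2 in (b), the two ends of P_3 in
    (c), and the facing ends [v] and [w] in (d). Only a one-vertex path could contribute an isolated
    vertex, and the forms rule that out. *)
Lemma listed_form_twins V1 V2 : V1 :|: V2 = [set: T] -> V1 :&: V2 = set0 ->
  listed_form e V1 V2 ->
  (forall x, nbhd e x != set0) /\ exists a b, twins e a b.
Proof.
move=> cov dis.
have inV x : (x \in V1) || (x \in V2) by rewrite -in_setU cov inE.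
have nV x : x \in V1 -> x \in V2 -> False.
  by move=> x1 x2; have := in_set0 x; rewrite -dis inE x1 x2.
have nbhdE x y : e x y = (y \in nbhd e x) by rewrite inE.
have single s V : path_listing e V s -> size s <= 1 -> exists x, V = [set x].
  case: s => [|x [|]] // [// _ _ -> _] _; exists x.
  by apply/setP=> y; rewrite !inE.
have dich V s : path_listing e V s ->
    (forall x, V = [set x] -> nbhd e x != set0) -> forall x, x \in V -> nbhd e x != set0.
  move=> pl n1 x; case: (ltnP 1 (size s)) => [s2|s1].
    exact: path_listing_not_isolated pl s2.
  have [y Ey] := single _ _ pl s1; rewrite Ey => /set1P->; exact: n1.
case.
- case=> x [s [Ex pl s3 H]]; have xV1 : x \in V1 by rewrite Ex set11.
  have [_ us Vs is_] := pl.
  have nx : (exists y, y \in nbhd e x) -> forall y, nbhd e y != set0.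
    move=> [z xz] y; case/orP: (inV y) => [|yV2].
      by rewrite Ex => /set1P->; apply/set0Pn; exists z.
    by apply: path_listing_not_isolated pl _ yV2; apply: ltnW.
  have in2 c : c != x -> c \in V2 by move=> cx; have := inV c; rewrite Ex inE (negPf cx).
  case: H => [[u [v [w [p [q [Es Nx]]]]]]|[v [w [q [Es Nx]]]]].
    have vV2 : v \in V2 by rewrite Vs Es !inE !mem_cat !inE eqxx !orbT.
    split; first by apply: nx; exists u; case: Nx => ->; rewrite !inE eqxx.
    exists x, v; split=> [|c cx cv]; first by apply: contraTneq vV2 => <-; apply/negP/nV.
    rewrite (path_listing_middle pl Es (in2 _ cx)) nbhdE.
    by case: Nx => ->; rewrite !inE ?(negPf cv) ?orbF.
  rewrite Es in pl; have vV2 : v \in V2 by rewrite Vs Es !inE eqxx.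
  split; first by apply: nx; exists w; case: Nx => ->; rewrite !inE eqxx ?orbT.
  exists x, v; split=> [|c cx cv]; first by apply: contraTneq vV2 => <-; apply/negP/nV.
  rewrite (path_listing_end pl (in2 _ cx)) nbhdE.
  by case: Nx => ->; rewrite !inE ?(negPf cv).
- case=> u [v [pl1 [s pl2] NE H]]; have [_ us V1s _] := pl1.
  split.
    move=> x; case/orP: (inV x); first exact: path_listing_not_isolated pl1 _.
    apply: dich pl2 _ x => x /H[]; rewrite e_sym => exu _; exact: not_isolated exu.
  exists u, v; split; first by move: us; rewrite /= inE andbT.
  move=> c cu cv; have := inV c; rewrite V1s !inE (negPf cu) (negPf cv) /= => c2.
  by have /setP/(_ c) := NE; rewrite !inE c2 !andbT.
- case=> u [v [w [pl1 [s pl2] NE H]]]; have [_ us _ _] := pl1.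
  split.
    move=> x; case/orP: (inV x); first exact: path_listing_not_isolated pl1 _.
    exact: dich pl2 H x.
  exists u, w; split; first by move: us; rewrite /= !inE negb_or => /andP[/andP[]].
  by move=> c _ _; rewrite !nbhdE; case: NE => [[-> ->]|[x _ [-> ->]]].
case=> s1 [s2 [v' [v [w [w' [pl1 pl2 HE]]]]]].
have sz1 : 2 <= size (s1 ++ [:: v'; v]) by rewrite size_cat leq_addl.
split.
  move=> x; case/orP: (inV x); first exact: path_listing_not_isolated pl1 _.
  exact: path_listing_not_isolated pl2 _.
have V1v : v \in V1 by case: pl1 => _ _ -> _; rewrite inE mem_cat !inE eqxx !orbT.
have V2w : w \in V2 by case: pl2 => _ _ -> _; rewrite !inE eqxx.
have vw : v != w by apply: contraTneq V2w => <-; apply/negP/nV.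
have vv' : v' != v.
  by case: pl1 => _; rewrite cat_uniq /= !inE => /and3P[_ _ /andP[]].
have ww' : w != w'.
  by case: pl2 => _ /=; rewrite inE negb_or => /andP[/andP[]].
exists v, w; split=> // c cv cw.
(* Apart from the pairs [v w] and [v' w'], where the three sets of edges differ, the cross edges are
   [v' w] and [v w']. *)
have cross x y : x \in V1 -> y \in V2 -> (x == v) && (y == w) = false ->
    ~~ ((x == v') && (y == w')) ->
    e x y = ((x == v') && (y == w)) || ((x == v) && (y == w')).
  move=> x1 y2 n1 n2.
  have -> : e x y = ((x, y) \in [set xy in setX V1 V2 | e xy.1 xy.2]).
    by rewrite !inE x1 y2.
  by case: HE => ->; rewrite !inE !xpair_eqE ?n1 ?(negPf n2) ?orbF.
have := path_listing_rev pl1; rewrite rev_cat /= => pl1r.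
case/orP: (inV c) => cV.
  rewrite (path_listing_end pl1r cV) e_sym cross // ?(negPf cv) ?eqxx ?andbT ?orbF //.
  by rewrite negb_and ww' orbT.
rewrite (path_listing_end pl2 cV) cross // ?(negPf cw) ?eqxx ?andbF ?orbF //.
by rewrite negb_and eq_sym vv'.
Qed.

End Listings.

(** * From twins to the listed forms *)

Section TwinForms.
Variables (T : finType) (e : rel T).
Hypotheses (e_sym : symmetric e) (e_irr : irreflexive e).
Hypothesis no_isolated : forall x, nbhd e x != set0.
Implicit Types (s : seq T) (V : {set T}).

Lemma twinsC a b : twins e a b -> twins e b a.
Proof. by case=> nab tw; split=> [|c cb ca]; [rewrite eq_sym | rewrite tw]. Qed.

Lemma path_listingP V s : path_listing e V s ->
  [/\ s != [::], uniq s, forall x, (x \in V) = (x \in s) &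
      {in V &, forall x y,
         e x y = (index y s == (index x s).+1) || (index x s == (index y s).+1)}].
Proof.
case=> s0 us -> is_; split=> // [x|x y]; rewrite !inE //; exact: is_.
Qed.

(** Twins on one induced path must be its two ends at distance 1 or 2, since any other path
    neighbour of one would not be a neighbour of the other. Distance 1 gives form (b) and distance 2
    gives form (c). *)
Lemma twins_same_path V1 V2 s1 s2 a b : path_listing e V1 s1 ->
  path_listing e V2 s2 -> full_layout e s1 s2 -> twins e a b ->
  a \in V1 -> b \in V1 -> form_b e V1 V2 \/ form_c e V1 V2.
Proof.
move=> pl1 pl2 [[us _ _ nc] cov].
have [s10 u1 V1s adj1] := path_listingP pl1; have [_ _ V2s _] := path_listingP pl2.
have dis x : x \in V1 -> x \in V2 -> False.
  rewrite V1s V2s => x1 x2; move: us; rewrite cat_uniq => /and3P[_ /hasPn/(_ x x2)].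
  by rewrite /= x1.
wlog lt_ab : a b / index a s1 < index b s1 => [wlog_lt | [nab tw] aV bV].
  move=> tw aV bV; case: (ltngtP (index a s1) (index b s1)) => [lt|lt|E].
  - exact: (wlog_lt a b).
  - by apply: (wlog_lt b a) => //; apply: twinsC.
  by case/eqP: (tw.1); apply: (index_inj a _ _ E); rewrite -V1s.
have nthV i : i < size s1 -> nth a s1 i \in V1 by move=> lt; rewrite V1s mem_nth.
have lt_b : index b s1 < size s1 by rewrite index_mem -V1s.
have same i : i < size s1 -> i != index a s1 -> i != index b s1 ->
    (i == (index a s1).+1) || (index a s1 == i.+1) =
    ((i == (index b s1).+1) || (index b s1 == i.+1)).
  move=> lt_i nia nib; have := tw (nth a s1 i).
  rewrite !adj1 ?nthV // index_uniq //; apply.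
    by apply: contraNneq nia => <-; rewrite index_uniq.
  by apply: contraNneq nib => <-; rewrite index_uniq.
(* A vertex before [a] would also have to be adjacent to [b], which is further along. The next two
   steps likewise use the vertex after [b] and the vertex in position 1. *)
have ia : index a s1 = 0.
  apply/eqP; apply/negP=> /negP ia; have := same (index a s1).-1; lia.
have ib : (index b s1).+1 = size s1.
  apply/eqP; apply/negP=> /negP ib; have := same (index b s1).+1; lia.
have ib2 : index b s1 <= 2.
  rewrite leqNgt; apply/negP=> ib2; have := same 1; lia.
have tw2 c : c \in V2 -> e a c = e b c.
  by move=> cV; apply: tw; apply: contraTneq cV => ->; apply/negP/dis.
have Ea : nth a s1 0 = a by rewrite -ia nth_index // -V1s.
have Eb : nth a s1 (index b s1) = b by rewrite nth_index // -V1s.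
have [ib1|ib1] : index b s1 = 1 \/ index b s1 = 2 by lia.
  have Es : s1 = [:: a; b].
    move: ib Ea Eb; rewrite ib1; case: (s1) => [|x [|y [|]]] //= _ <- <- //.
  left; exists a, b; split; rewrite -?Es //; first by exists s2.
    by apply/setP=> c; rewrite !inE; case: (boolP (c \in V2)) => [/tw2->|]; rewrite ?andbF.
  move=> x V2x; have xV2 : x \in V2 by rewrite V2x set11.
  have [y] := set0Pn _ (no_isolated x); rewrite inE e_sym => eyx.
  have := cov y; rewrite mem_cat -V1s -V2s V2x V1s Es !inE orbC.
  case: eqP => [Eyx|_ /=]; first by rewrite Eyx e_irr in eyx.
  by case/orP=> /eqP Ey; rewrite Ey in eyx; rewrite ?(tw2 _ xV2) ?eyx // -?(tw2 _ xV2).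
have [m Es] : exists m, s1 = [:: a; m; b].
  move: ib Ea Eb; rewrite ib1; case: (s1) => [|x [|m [|y [|]]]] //= _ <- <- //.
  by exists m.
have mV : m \in V1 by rewrite V1s Es !inE eqxx orbT.
have Na c : c \in V1 -> e a c = (c == m).
  by move=> cV; rewrite Es in pl1; rewrite (path_listing_end pl1 cV).
have am : a != m by move: u1; rewrite Es /= !inE negb_or => /andP[/andP[]].
have bm : b != m by rewrite eq_sym; move: u1; rewrite Es /= !inE andbT => /andP[].
have NE : nbhd e b = nbhd e a.
  apply/setP=> c; rewrite !inE; have [->|ca] := eqVneq c a.
    by rewrite e_sym Na // (negPf bm) e_irr.
  by have [->|cb] := eqVneq c b; [rewrite Na // (negPf bm) e_irr | rewrite tw].
right; exists a, m, b; rewrite -Es NE; split=> //; first by exists s2.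
case: (pickP [pred x in V2 | e a x]) => [x /andP[/= xV eax]|nox]; [right|left].
  exists x => //; suff -> : nbhd e a = [set m; x] by [].
  apply/setP=> c; rewrite !inE.
  have := cov c; rewrite mem_cat -V1s -V2s => /orP[cV|cV].
    by rewrite Na // [c == x]negbTE ?orbF //; apply: contraTneq cV => ->; apply/negP=> /dis; apply.
  rewrite [c == m]negbTE /=; last by apply: contraTneq cV => ->; apply/negP/dis.
  apply/idP/eqP=> [eac|-> //].
  have xs : x \in s2 by rewrite -V2s.
  have cs : c \in s2 by rewrite -V2s.
  (* Both [x] and [c] are adjacent to both [a] and [b]. Not crossing, applied to the two ways of
     pairing them, gives inequalities in both directions. *)
  apply: (@index_inj _ c s2) => //; apply/eqP; rewrite /= eqn_leq.
  by rewrite !(nc a b) -?V1s -?tw2.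
suff -> : nbhd e a = [set m] by [].
apply/setP=> c; rewrite !inE.
have := cov c; rewrite mem_cat -V1s -V2s => /orP[/Na //|cV].
have := nox c; rewrite /= cV /= => ->; apply/esym/negbTE.
by apply: contraTneq cV => ->; apply/negP/dis.
Qed.

Hypothesis not_path : ~ is_path_graph e.

(** If V has one vertex the graph is P_2, which is excluded. If V has two, the graph is a triangle,
    of form (b), or P_3, which is excluded. Otherwise [b] plays the part of [x] in form (a)(ii). *)
Lemma twins_end V a b q : path_listing e V (a :: q) -> V :|: [set b] = [set: T] ->
  b \notin V -> twins e a b ->
  listed_form e V [set b] \/ listed_form e [set b] V.
Proof.
move=> pl cov bV [nab tw]; have [_ u1 V1s adj1] := path_listingP pl.
have inV c : (c \in V) || (c == b) by have := in_setT c; rewrite -cov !inE.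
have plb : path_listing e [set b] [:: b].
  split=> //; first by apply/setP=> c; rewrite !inE.
  by move=> x y; rewrite !inE => /eqP-> /eqP->; rewrite e_irr /= eqxx.
case: q => [|w [|w2 q]] in pl u1 V1s adj1 *.
- have eab : e a b.
    have [y] := set0Pn _ (no_isolated a); rewrite inE => eay.
    have := inV y; rewrite V1s !inE => /orP[]/eqP Ey; rewrite Ey ?e_irr // in eay.
  case: not_path; exists [:: a; b]; split=> //; first by rewrite /= inE nab.
    by apply/setP=> c; rewrite !inE; have := inV c; rewrite V1s !inE => ->.
  move=> x y; rewrite !inE => /orP[]/eqP-> /orP[]/eqP->;
    by rewrite ?e_irr ?[e b a]e_sym ?eab /= ?eqxx ?(negPf nab) ?[b == a]eq_sym ?(negPf nab).
- have wV : w \in V by rewrite V1s !inE eqxx orbT.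
  have eaw : e a w by rewrite (path_listing_end pl).
  have wa : w != a by apply: contraTneq eaw => ->; rewrite e_irr.
  have wb : w != b by apply: contraNneq bV => <-.
  have ebw : e b w by rewrite -tw.
  case: (boolP (e a b)) => eab.
    left; apply: Or42; exists a, w; split=> //; first by exists [:: b].
      apply/setP=> c; rewrite !inE; case: eqP => [->|]; rewrite ?andbF //.
      by rewrite eab e_sym ebw.
    by move=> x /set1_inj <-; rewrite eab e_sym ebw.
  case: not_path; exists [:: a; w; b]; split=> //.
  + by rewrite /= !inE negb_or nab eq_sym wa wb.
  + apply/setP=> c; rewrite !inE; have := inV c; rewrite V1s !inE -orbA => -> //.
  have [aw bw ba] : [/\ a == w = false, b == w = false & b == a = false].
    by split; rewrite eq_sym; apply/negbTE.
  move=> x y; rewrite !inE => /or3P[]/eqP-> /or3P[]/eqP->;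
    rewrite ?e_irr ?[e b _]e_sym ?[e w a]e_sym ?[e w b]e_sym ?ebw ?eaw ?(negPf eab) /=
      ?eqxx ?(negPf nab) ?(negPf wa) ?(negPf wb) ?aw ?bw ?ba ?eqxx //.
right; apply: Or41; exists b, [:: a, w, w2 & q]; split=> //.
right; exists a, w, (w2 :: q); split=> //.
have aV : a \in V by rewrite V1s inE eqxx.
have wV : w \in V by rewrite V1s !inE eqxx orbT.
have Nb c : c != a -> e b c = (c == w).
  move=> ca; have := inV c; have [-> _|cb cV] := eqVneq c b.
    by rewrite e_irr; apply/esym/negbTE; apply: contraNneq bV => ->.
  by rewrite -tw // (path_listing_end pl) //; rewrite orbF in cV.
have aw : (a == w) = false.
  by apply/negbTE; apply: contraTneq u1 => ->; rewrite /= !inE eqxx.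
by case eba : (e b a); [right | left]; apply/setP=> c; rewrite !inE;
  have [->|ca] := eqVneq c a; rewrite ?eba ?aw ?Nb.
Qed.

(** An end vertex [a] falls under [twins_end], after reversal if it is the last one; an interior [a]
    is the middle of the subpath in form (a)(i). *)
Lemma twins_single V s a b : path_listing e V s -> V :|: [set b] = [set: T] ->
  b \notin V -> a \in V -> twins e a b ->
  listed_form e V [set b] \/ listed_form e [set b] V.
Proof.
move=> pl cov bV aV tw; have [_ u1 V1s _] := path_listingP pl.
have inV c : (c \in V) || (c == b) by have := in_setT c; rewrite -cov !inE.
have [p [q Es]] : exists p q, s = p ++ a :: q.
  by move: aV; rewrite V1s; case/splitPr=> p q; exists p, q.
case/lastP: p => [|p u] in Es; first by rewrite Es in pl; apply: twins_end pl _ _ tw.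
case: q => [|w q] in Es.
  have := path_listing_rev pl; rewrite Es rev_cat => plr.
  exact: twins_end plr cov bV tw.
right; apply: Or41; exists b, s; split=> //.
  by rewrite Es size_cat size_rcons /= addSn addnS ltnS addnS.
rewrite cat_rcons in Es; left; exists u, a, w, p, q; split=> //.
have [nab twc] := tw.
have Nb c : c != a -> e b c = (c == u) || (c == w).
  move=> ca; have := inV c; have [-> _|cb cV] := eqVneq c b.
    rewrite e_irr; apply/esym/norP; split; apply: contraNneq bV => ->;
      by rewrite V1s Es !mem_cat !inE eqxx ?orbT.
  by rewrite -twc // (path_listing_middle pl Es) //; rewrite orbF in cV.
have [au aw] : a == u = false /\ a == w = false.
  split; apply/negbTE; apply: contraTneq u1 => E; rewrite Es E cat_uniq /= !inE eqxx ?orbT /= ?andbF //.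
case eba : (e b a); [right | left]; apply/setP=> c; rewrite !inE;
  have [->|ca] := eqVneq c a; rewrite ?eba ?au ?aw ?Nb ?eqxx ?orbT ?orbF //.
Qed.

(** The path edges [a v'] and [b w'] are copied by the twin into the cross edges [v' b] and [a w'].
    These confine all cross edges to the four pairs formed by [v'], [a] and [b], [w']. The two
    remaining pairs, [v' w'] and [a b], would cross, so at most one is an edge. *)
Lemma twins_facing_ends V1 V2 s1 s2 a b : path_listing e V1 s1 ->
  path_listing e V2 s2 -> full_layout e s1 s2 -> twins e a b ->
  a \in V1 -> b \in V2 -> 0 < index a s1 -> (index a s1).+1 = size s1 ->
  index b s2 = 0 -> 1 < size s2 -> form_d e V1 V2.
Proof.
move=> pl1 pl2 [[us _ _ nc] cov] [nab tw] aV bV ia0 ia ib sz2.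
have [_ u1 V1s adj1] := path_listingP pl1; have [_ u2 V2s adj2] := path_listingP pl2.
have [p [v' Es1]] : exists p v', s1 = p ++ [:: v'; a].
  have : nth a s1 (index a s1) = a by rewrite nth_index // -V1s.
  case/lastP: (s1) ia0 ia => // s x; rewrite size_rcons => i0 [ii].
  rewrite ii nth_rcons ltnn eqxx => ->.
  case/lastP: s ii i0 => [/= -> //|p v' _ _]; exists p, v'.
  by rewrite -!cats1 -catA.
have [w' [q Es2]] : exists w' q, s2 = [:: b, w' & q].
  move: ib sz2 bV; rewrite V2s; case: (s2) => [|x [|w' q]] //=; case: eqP => // -> _ _ _.
  by exists w', q.
exists p, q, v', a, b, w'; rewrite -Es1 -[[:: b; w'] ++ q]Es2; split=> //.
have uV x : x \in V1 -> x \notin V2.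
  rewrite V1s V2s => x1; move: us; rewrite cat_uniq => /and3P[_ /hasPn us _].
  by apply: contraTN x1 => /us.
have v'V : v' \in V1 by rewrite V1s Es1 mem_cat !inE eqxx orbT.
have w'V : w' \in V2 by rewrite V2s Es2 !inE eqxx orbT.
have eav' : e a v'.
  have := path_listing_rev pl1; rewrite Es1 rev_cat /= => plr.
  by rewrite (path_listing_end plr).
have ebw' : e b w' by move: (pl2); rewrite Es2 => plr; rewrite (path_listing_end plr).
have neq x y : x \in V1 -> y \in V2 -> x != y.
  by move=> /uV xV2; apply: contraTneq => <-.
have v'a : v' != a by apply: contraTneq eav' => ->; rewrite e_irr.
have w'b : w' != b by apply: contraTneq ebw' => ->; rewrite e_irr.
have ev'b : e v' b by rewrite e_sym -tw // neq.
have eaw' : e a w' by rewrite tw // eq_sym neq.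
have iv' : (index v' s1).+2 = size s1.
  rewrite Es1 index_cat size_cat /= eqxx addn0 addn2.
  by move: u1; rewrite Es1 cat_uniq /= negb_or => /and3P[_ /andP[/negPf->]].
have iw' : index w' s2 = 1 by rewrite Es2 /= eq_sym (negPf w'b) eqxx.
have lt_v'a : index v' s1 < index a s1 by rewrite -ltnS iv' ia.
have idx1 x : x \in V1 -> x != a -> x != v' -> index x s1 < index v' s1.
  move=> xV xa xv'; have neqi z : z \in V1 -> x != z -> index x s1 != index z s1.
    by move=> zV; apply: contraNneq => E; apply/eqP; apply: (index_inj z _ _ E); rewrite -V1s.
  have lt_x : index x s1 < size s1 by rewrite index_mem -V1s.
  move: (neqi _ aV xa) (neqi _ v'V xv') lt_x; rewrite -iv' !ltnS.
  move: ia; rewrite -iv' => -[->]; rewrite [_ <= (_).+1]leq_eqVlt ltnS.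
  by move=> /negPf-> /= nx; rewrite leq_eqVlt (negPf nx).
have idx2 y : y \in V2 -> y != b -> y != w' -> 1 < index y s2.
  move=> yV yb yw'; have neqi z : z \in V2 -> y != z -> index y s2 != index z s2.
    by move=> zV; apply: contraNneq => E; apply/eqP; apply: (index_inj z _ _ E); rewrite -V2s.
  move: (neqi _ bV yb) (neqi _ w'V yw'); rewrite ib iw'.
  by case: (index y s2) => [|[]].
(* A cross edge at [a] or [b] is copied by the twin to a path edge, which fixes its other end. For
   any other edge, an [x] before [v'] would cross [v' b], and a [y] beyond [w'] at [x = v'] would
   cross [a w']. *)
have edge x y : x \in V1 -> y \in V2 -> e x y ->
    ((x == v') || (x == a)) && ((y == b) || (y == w')).
  move=> xV yV exy; have [Ex|xa] := eqVneq x a.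
    rewrite orbT /=; have [//|yb /=] := eqVneq y b.
    have : e b y by rewrite -tw -?Ex // eq_sym neq.
    by rewrite Es2 in pl2; rewrite (path_listing_end pl2).
  rewrite orbF; have [Ey|yb] := eqVneq y b.
    rewrite andbT; have : e a x by rewrite tw -?Ey 1?e_sym // neq.
    have := path_listing_rev pl1; rewrite Es1 rev_cat /= => plr.
    by rewrite (path_listing_end plr).
  rewrite /=; have := nc x v'; have := nc v' a; rewrite -!V1s.
  move=> /(_ v'V aV y w') + /(_ xV v'V y b); rewrite -!V2s.
  move=> /(_ yV w'V) nc1 /(_ yV bV exy ev'b) nc2.
  have [Ex|xv'] := eqVneq x v'; last first.
    by have := nc2 (idx1 _ xV xa xv'); rewrite ib leqn0 -ib => /eqP E;
       case/eqP: yb; apply: (index_inj b _ _ E); rewrite -V2s.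
  apply: contraT => yw'; have := idx2 _ yV yb yw'; rewrite ltnNge.
  by rewrite -iw' nc1 // -Ex.
have one : e v' w' -> e a b = false.
  move=> ev'w'; apply/negP=> eab.
  have := nc v' a _ _ w' b; rewrite -!V1s -!V2s iw' ib.
  by move=> /(_ v'V aV w'V bV ev'w' eab lt_v'a).
have EE x y : ((x, y) \in [set xy in setX V1 V2 | e xy.1 xy.2]) =
    [|| (x == v') && (y == b), (x == a) && (y == w'),
        e v' w' && ((x == v') && (y == w')) | e a b && ((x == a) && (y == b))].
  rewrite !inE /=; apply/idP/idP=> [/andP[/andP[xV yV] exy]|].
    by move: (exy); case/andP: (edge _ _ xV yV exy) => /orP[]/eqP-> /orP[]/eqP-> Exy;
       rewrite ?Exy !eqxx ?orbT.
  case/or4P=> [/andP[/eqP-> /eqP->]|/andP[/eqP-> /eqP->]|/and3P[? /eqP-> /eqP->]|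
               /and3P[? /eqP-> /eqP->]]; by rewrite ?v'V ?aV ?bV ?w'V.
case: (boolP (e v' w')) => ev'w'; last case: (boolP (e a b)) => eab.
- apply: Or32; apply/setP=> -[x y]; rewrite EE ev'w' one // !inE !xpair_eqE /= orbF.
  by rewrite orbA.
- apply: Or33; apply/setP=> -[x y]; rewrite EE (negPf ev'w') eab !inE !xpair_eqE /=.
  by rewrite orbA.
apply: Or31; apply/setP=> -[x y].
by rewrite EE (negPf ev'w') (negPf eab) !inE !xpair_eqE /= !orbF.
Qed.

(** When the twins lie on different paths with at least two vertices each, [cross] forces one to be
    first on its path and the other last, so that they face each other. *)
Lemma twins_listed_form V1 V2 s1 s2 a b : path_listing e V1 s1 ->
  path_listing e V2 s2 -> full_layout e s1 s2 -> twins e a b ->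
  listed_form e V1 V2 \/ listed_form e V2 V1.
Proof.
have symm s t : full_layout e s t -> full_layout e t s.
  by case=> ly cov; split=> [|x]; [exact: layoutC | rewrite mem_cat orbC -mem_cat].
wlog aV : V1 V2 s1 s2 / a \in V1 => [wlog_a pl1 pl2 ly tw|].
  have [_ _ V1s _] := path_listingP pl1; have [_ _ V2s _] := path_listingP pl2.
  case/orP: (etrans (esym (mem_cat _ _ _)) (ly.2 a)); rewrite -?V1s -?V2s => aV.
    exact: (wlog_a V1 V2 s1 s2).
  by rewrite or_comm; apply: (wlog_a V2 V1 s2 s1) => //; apply: symm.
move=> pl1 pl2 ly tw; have lyC := symm _ _ ly.
have [s10 u1 V1s adj1] := path_listingP pl1; have [s20 u2 V2s adj2] := path_listingP pl2.
case/orP: (etrans (esym (mem_cat _ _ _)) (ly.2 b)); rewrite -?V1s -?V2s => bV.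
  by left; case: (twins_same_path pl1 pl2 ly tw aV bV); [apply: Or42 | apply: Or43].
have uV x : x \in V1 -> x \notin V2.
  have [[+ _ _ _] _] := ly; rewrite V1s V2s cat_uniq => /and3P[_ /hasPn us _] x1.
  by apply: contraTN x1 => /us.
have cov : V1 :|: V2 = [set: T].
  by apply/setP=> x; rewrite !inE V1s V2s -mem_cat ly.2.
have single V s x : path_listing e V s -> x \in V -> size s <= 1 -> V = [set x].
  move=> pl; have [sn0 _ Vs _] := path_listingP pl.
  case: s sn0 Vs {pl} => [|y []] // _ Vs; rewrite Vs inE => /eqP-> _.
  by apply/setP=> z; rewrite Vs !inE.
have [s2_1|s2_2] := leqP (size s2) 1.
  have E2 := single _ _ _ pl2 bV s2_1; rewrite E2.
  apply: twins_single pl1 _ _ aV tw; rewrite -?E2 //.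
  by apply: contraTN bV => /uV.
have [s1_1|s1_2] := leqP (size s1) 1.
  have E1 := single _ _ _ pl1 aV s1_1; rewrite E1 or_comm.
  apply: twins_single pl2 _ _ bV (twinsC tw); rewrite -?E1 ?uV // setUC //.
have lt_a : index a s1 < size s1 by rewrite index_mem -V1s.
have lt_b : index b s2 < size s2 by rewrite index_mem -V2s.
have [[us _ _ nc] _] := ly; have [nab twc] := tw.
have neq x y : x \in V1 -> y \in V2 -> x != y.
  by move=> /uV xV2; apply: contraTneq => <-.
(* A neighbour of a on its path is a neighbour of b, and conversely; one
   before a and one before b, or one after each, give crossing edges. *)
have cross i j : i < size s1 -> j < size s2 ->
    (index a s1 == i.+1) && (index b s2 == j.+1) ||
    (i == (index a s1).+1) && (j == (index b s2).+1) -> False.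
  move=> lt_i lt_j H; pose x := nth a s1 i; pose y := nth b s2 j.
  have xs : x \in s1 by rewrite mem_nth.
  have ys : y \in s2 by rewrite mem_nth.
  have as1 : a \in s1 by rewrite -V1s.
  have bs2 : b \in s2 by rewrite -V2s.
  have ix : index x s1 = i by rewrite index_uniq.
  have iy : index y s2 = j by rewrite index_uniq.
  have eax : e a x.
    by rewrite adj1 ?V1s // ix; case/orP: H => /andP[-> _]; rewrite ?orbT.
  have eby : e b y.
    by rewrite adj2 ?V2s // iy; case/orP: H => /andP[_ ->]; rewrite ?orbT.
  have exb : e x b.
    rewrite e_sym -twc //; first by apply: contraTneq eax => ->; rewrite e_irr.
    by rewrite neq // V1s.
  have eay : e a y.
    rewrite twc //; last by apply: contraTneq eby => ->; rewrite e_irr.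
    by rewrite eq_sym neq // V2s.
  case/orP: H => /andP[/eqP ai /eqP bj].
    by have := nc x a xs as1 b y bs2 ys exb eay; rewrite ix iy ai bj ltnn => /(_ (leqnn _)).
  by have := nc a x as1 xs y b ys bs2 eay exb; rewrite ix iy ai bj ltnn => /(_ (leqnn _)).
have [ia|ia] := posnP (index a s1).
  have ib : (index b s2).+1 = size s2.
    apply/eqP; rewrite eqn_leq lt_b leqNgt; apply/negP=> lt_b1.
    by apply: (cross 1 (index b s2).+1) => //; rewrite ia !eqxx orbT.
  right; apply: Or44; apply: (twins_facing_ends pl2 pl1 lyC (twinsC tw)) => //.
  by rewrite -ltnS ib.
have ib : index b s2 = 0.
  apply/eqP; rewrite -leqn0 leqNgt; apply/negP=> ib.
  apply: (cross (index a s1).-1 (index b s2).-1).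
  - exact: leq_ltn_trans (leq_pred _) lt_a.
  - exact: leq_ltn_trans (leq_pred _) lt_b.
  by rewrite !prednK // !eqxx.
left; apply: Or44; apply: (twins_facing_ends pl1 pl2 ly tw) => //.
apply/eqP; rewrite eqn_leq lt_a leqNgt; apply/negP=> lt_a1.
by apply: (cross (index a s1).+1 1) => //; rewrite ib !eqxx orbT.
Qed.

End TwinForms.

(** * Paths *)

Section PathForts.
Variables (T : finType) (e : rel T).
Hypotheses (e_sym : symmetric e) (e_irr : irreflexive e).

(* A fort contains the first vertex, and each missed vertex is followed by one
   that it contains; the even positions and the last one form a fort. *)
Lemma path_fort_number s : path_listing e [set: T] s ->
  #|T| < (fort_number e).*2 <= #|T|.+2.
Proof.
move=> pl; have [s0 us Vs adj] := path_listingP pl.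
have sT x : x \in s by rewrite -Vs inE.
have cT : #|T| = size s by rewrite -(card_uniqP us); apply: eq_card => x; rewrite sT.
case Es: s => [|x0 s'] //; first by rewrite Es in s0.
have T0 : 0 < #|T| by rewrite cT Es.
have nbr x y : e x y = (index y s == (index x s).+1) || (index x s == (index y s).+1).
  by rewrite adj ?inE.
have lt x : index x s < size s by rewrite index_mem.
have nthK i : i < size s -> index (nth x0 s i) s = i by move=> lti; rewrite index_uniq.
have inj : injective (index^~ s) by move=> x y /(index_inj x0) ->.
apply/andP; split.
  have [[W fW <-] _] := fort_numberP e T0.
  have x0W : x0 \in W.
    have [ly _] := (path_listing_full e s).1 pl.
    have /zero_forcingP/(_ W fW) := full_layout_zf e_sym ly.
    rewrite (_ : [set _ in _] = [set x0]); last first.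
      by apply/setP=> x; rewrite Es /= take0 !inE.
    by rewrite disjoint_sym disjoints1 negbK.
  have step i : i.+1 < size s -> nth x0 s i \in W -> nth x0 s i.+1 \notin W ->
      i.+2 < size s /\ nth x0 s i.+2 \in W.
    move=> lt_i iW i1W; have lt_i' := ltnW lt_i.
    have e_i : e (nth x0 s i.+1) (nth x0 s i) by rewrite nbr !nthK // eqxx orbT.
    have [z zW /andP[]] := fort_other_nbr fW i1W iW e_i.
    rewrite nbr nthK // => /orP[/eqP iz|/eqP[iz]] ne.
      by rewrite -iz lt nth_index.
    by case/eqP: ne; rewrite iz nth_index.
  have consec i : i.+1 < size s -> (nth x0 s i \in W) || (nth x0 s i.+1 \in W).
    elim: i => [|i IHi] lt_i; first by rewrite Es /= x0W.
    case: (boolP (nth x0 s i.+1 \in W)) => //= i1W.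
    have := IHi (ltnW lt_i); rewrite (negPf i1W) orbF => iW.
    by case: (step i (ltnW lt_i) iW i1W).
  (* The successor map injects the complement of [W] into [W] without its first vertex, so n - |W|
     is at most |W| - 1. *)
  pose next x := nth x0 s (index x s).+1.
  have nextP x : x \notin W -> (index x s).+1 < size s /\ next x \in W.
    move=> xW; have : nth x0 s (index x s) \notin W by rewrite nth_index.
    rewrite /next; have := lt x; case: (index x s) => [|i] lt_i niW.
      by move: niW; rewrite Es /= x0W.
    have := consec i lt_i; rewrite (negPf niW) orbF => iW; exact: step.
  have sub : next @: (~: W) \subset W :\ x0.
    apply/subsetP=> _ /imsetP[x xW ->]; rewrite inE in xW.
    have [lt_x xnW] := nextP x xW; rewrite !inE xnW andbT.
    apply: contra_eqN (nthK _ lt_x) => /eqP Ex; rewrite -/(next x) Ex.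
    by rewrite Es /= eqxx.
  have := subset_leq_card sub; rewrite card_in_imset; last first.
    move=> x y; rewrite !inE => /nextP[ltx _] /nextP[lty _] /(congr1 (index^~ s)).
    by rewrite /= /next !nthK // => -[/inj].
  by have := cardsC W; rewrite (cardsD1 x0 W) x0W; lia.
set W := [set x | ~~ odd (index x s) || ((index x s).+1 == size s)].
have x0W : x0 \in W by rewrite inE Es /= eqxx.
apply: (@leq_trans #|W|.*2).
  rewrite leq_double; apply: (fort_numberP e T0).2.
  apply/andP; split; first by apply/set0Pn; exists x0.
  apply/forallP=> v; apply/implyP; rewrite inE negb_or negbK => /andP[odd_v last_v].
  have lt_v1 : (index v s).+1 < size s by rewrite ltn_neqAle last_v lt.
  have lt_v0 : (index v s).-1 < size s by apply: leq_ltn_trans (leq_pred _) (lt v).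
  have v0 : 0 < index v s by apply: odd_gt0.
  apply/negP=> /cards1P[y Ey].
  have Ny i : i < size s -> (i == (index v s).+1) || (index v s == i.+1) ->
      ~~ odd i -> nth x0 s i = y.
    by move=> lti adj_i ev_i; apply/set1P; rewrite -Ey !inE nbr nthK // adj_i ev_i.
  have := Ny _ lt_v1; rewrite eqxx /= negbK => /(_ isT odd_v) Ev1.
  have := Ny _ lt_v0; rewrite prednK // eqxx orbT => /(_ isT).
  rewrite -subn1 oddB // odd_v => /(_ isT) Ev0.
  have := nthK _ lt_v1; rewrite Ev1 -Ev0 nthK ?subn1 // => E.
  by have := leq_pred (index v s); rewrite E ltnn.
(* The predecessor map injects [W], without the first and the last vertex, into the complement of
   [W]. This gives 2|W| at most n + 2. *)
pose prev x := nth x0 s (index x s).-1; pose xl := nth x0 s (size s).-1.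
have sub : prev @: (W :\ x0 :\ xl) \subset ~: W.
  apply/subsetP=> _ /imsetP[x + ->]; rewrite !inE => /and3P[xxl xx0 xW].
  have lt0 : (index x s).-1 < size s by apply: leq_ltn_trans (leq_pred _) (lt x).
  have ix0 : 0 < index x s.
    rewrite lt0n; apply: contraNneq xx0 => ix; apply/eqP; apply: inj.
    by rewrite ix Es /= eqxx.
  have lx : (index x s).+1 == size s = false.
    apply/negbTE; apply: contraNneq xxl => ix; apply/eqP; apply: inj.
    by rewrite /xl -ix /= nth_index.
  rewrite lx orbF in xW; rewrite nthK // prednK // (ltn_eqF (lt x)) orbF negbK.
  by rewrite -subn1 oddB // (negPf xW).
have := subset_leq_card sub; rewrite card_in_imset; last first.
  have pos x : x \in W :\ x0 :\ xl -> 0 < index x s.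
    rewrite !inE => /and3P[_ xx0 _]; rewrite lt0n; apply: contraNneq xx0 => ix.
    by apply/eqP; apply: inj; rewrite ix Es /= eqxx.
  move=> x y /pos ix /pos iy /(congr1 (index^~ s)).
  have lt0 z : (index z s).-1 < size s by apply: leq_ltn_trans (leq_pred _) (lt z).
  by rewrite /= !nthK // => /(congr1 S); rewrite !prednK // => /inj.
have := cardsC W; rewrite (cardsD1 x0 W) x0W (cardsD1 xl (W :\ x0)).
case: (xl \in _) => /=; lia.
Qed.
End PathForts.

(** * The characterization of span n - 3 *)

Unset Implicit Arguments.
Local Open Scope ring_scope.

Theorem theorem17 (R : realType) (T : finType) (e : rel T)
    (e_sym : symmetric e) (e_irr : irreflexive e) (n : nat)
    (n_def : n = #|T|) (n_gt0 : (0 < n)%N) :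
  (zf_span e)%:Z = n%:Z - 3 <->
  [\/ two_parallel_paths_plus_K1 R e,
      is_path_graph e /\ (n = 4%N \/ n = 5%N) |
      two_parallel_paths R e /\
      forall (p : T -> 'rV[R]_2) (V1 V2 : {set T}),
        standard_drawing e p V1 V2 ->
        listed_form e V1 V2 \/ listed_form e V2 V1].
Proof.
rewrite {n}n_def in n_gt0 *.
have span := zf_spanE e n_gt0.
have z_gt0 := zf_number_gt0 e n_gt0; have f_gt0 := fort_number_gt0 e n_gt0.
have -> : (zf_span e)%:Z = #|T|%:Z - 3 <-> (zf_number e + fort_number e = 4)%N.
  split=> H; lia.
have pathP := zf_number_le1P e_sym e_irr n_gt0.
have isolatedP := fort_number_le1P n_gt0 e_sym e_irr.
have plus_K1 x : nbhd e x = set0 -> two_parallel_paths R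
    (fun a b : {y : T | y != x} => e (val a) (val b)) <-> zf_number e = 3%N.
  move=> x_isolated; rewrite (zf_number_isolated e_sym x_isolated).
  have := @two_parallel_pathsP R _ (fun a b : {y : T | y != x} => e (val a) (val b))
    (fun a b => e_sym _ _) (fun a => e_irr _).
  by move=> ->; split=> [->|[]].
split=> [zf4|].
  have [z1|z2] := leqP (zf_number e) 1.
    apply: Or32; have /pathP path := z1; split=> //.
    (* Here Z = 1 and f = 3, and n < 2f <= n + 2 leaves n = 4 or n = 5. *)
    have [s /(path_fort_number e_sym)] := path; lia.
  have [f1|f2] := leqP (fort_number e) 1.
    have /isolatedP[x x_isolated] := f1.
    apply: Or31; exists x; split=> //; apply/plus_K1 => //; lia.
  (* Both Z and f are now at least 2 with sum 4, so both equal 2. *)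
  apply: Or33; split; first by apply/(two_parallel_pathsP R e_sym e_irr); lia.
  have no_isolated x : nbhd e x != set0.
    by apply: contraTneq f2 => Nx; rewrite -leqNgt; apply/isolatedP; exists x.
  have not_path : ~ is_path_graph e by move/pathP; rewrite leqNgt z2.
  have [|[x Nx]|[a [b tw]]] := (fort_number_le2P n_gt0 e_sym e_irr).1; first by lia.
    by have := no_isolated x; rewrite Nx eqxx.
  move=> p V1 V2 /standard_drawing_layout[s1 [s2 [pl1 pl2 ly]]].
  exact: (twins_listed_form e_sym e_irr no_isolated not_path pl1 pl2 ly tw).
case=> [[x [Nx /(plus_K1 _ Nx) z3]]|[path n45]|[par forms]].
- have f1 : (fort_number e <= 1)%N by apply/isolatedP; exists x.
  lia.
- have /pathP z1 := path.
  have [s /(path_fort_number e_sym)] := path; lia.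
have z2 := (two_parallel_pathsP R e_sym e_irr).1 par.
(* The condition on all standard drawings is needed for one only, and [par] supplies it. *)
have [_ [p [V1 [V2 drawn]]]] := par; have [cov dis _ _] := drawn.
have [no_isolated tw] : (forall x, nbhd e x != set0) /\ exists a b, twins e a b.
  case: (forms p V1 V2 drawn); first exact: listed_form_twins.
  by apply: listed_form_twins; rewrite // (setUC, setIC).
have f_le2 : (fort_number e <= 2)%N.
  by apply/(fort_number_le2P n_gt0 e_sym e_irr); right.
have f_gt1 : (1 < fort_number e)%N.
  by rewrite ltnNge; apply/negP=> /isolatedP[x Nx]; have := no_isolated x; rewrite Nx eqxx.
lia.
Qed.
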